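(* Let $(I_t^{(n)})_{t\in[T_0,T_n]}=(S_t^{(n)}+A_t^{(n)})_{t\in[T_0,T_n]}$ be a Gaussian $X$-randomised arcade process on $\{T_0,T_n\}_*$, with signal function $S_t^{(n)}=\sum_{i=0}^n g_i(t)X_i$ and noise process $(A_t^{(n)})$ with covariance function $K_A$. Then $(I_t^{(n)})$ is $\{T_0,T_n\}_*$-conditionally Markov if the following conditions are all satisfied: 1. The arcade process $(A_t^{(n)})$ is Markov, i.e., there are real functions $A_1,A_2$ on $[T_0,T_n]$ with $$K_A(s,t)=\sum_{i=0}^{n-1}A_1(\min(s,t))A_2(\max(s,t))\mathbf 1_{(T_i,T_{i+1})}(s,t),$$ where $\mathbf 1_{(T_i,T_{i+1})}(s,t)=1$ if $s,t\in(T_i,T_{i+1})$ and $0$ otherwise. 2. For all $j=1,\dots,n$: $g_j(x)=0$ for all $x\in[T_0,T_{j-1}]$; and the restriction of $A_1$ to $(T_{j-1},T_j)$ has a continuous extension $A_1^{(j)}$ to $[T_{j-1},T_j]$ satisfying $$g_j(x)\,A_1^{(j)}(T_j)=A_1^{(j)}(x)\qquad\text{for all } x\in[T_{j-1},T_j].$$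
   Context: Fix dates $0\leqslant T_0<T_1<\dots<T_n<\infty$, $n\geqslant 1$; $\{T_0,T_n\}_*:=\{T_0,T_1,\dots,T_n\}$ and $(T_0,T_n)_*:=\bigcup_{i=0}^{n-1}(T_i,T_{i+1})$. On a probability space $(\Omega,\mathcal F,\mathbb P)$ let $(D_t)_{t\in[T_0,T_n]}$ (the driver) be a real sample-continuous stochastic process such that for all $c\in\mathbb{R}$, $\mathbb P[D_t=c]<1$ for all $t\in(T_0,T_n)_*$, and let $X=(X_0,\dots,X_n)$ be an $\mathbb{R}^{n+1}$-valued random vector independent of $(D_t)$ (the components of $X$ may be mutually dependent). Functions $f_0,\dots,f_n\in C^0([T_0,T_n],\mathbb{R})$ are interpolating coefficients on $\{T_0,T_n\}_*$ if $f_i(T_i)=1$ and $f_i(T_j)=0$ for $i\neq j$. An $X$-randomised arcade process ($X$-RAP) is a process $$I_t^{(n)}:=D_t-\sum_{i=0}^n\bigl(f_i(t)D_{T_i}-g_i(t)X_i\bigr),$$ where $f_0,\dots,f_n$ and $g_0,\dots,g_n$ are two sets of interpolating coefficients. Its signal function is $S_t^{(n)}=\sum_{i=0}^n g_i(t)X_i$ and its noise process is the arcade process $A_t^{(n)}=D_t-\sum_{i=0}^n f_i(t)D_{T_i}$. The RAP is Gaussian if its driver $(D_t)$ is a Gaussian process. Let $\mathcal F_t^I=\sigma(I_u^{(n)}:T_0\leqslant u\leqslant t)$. $(I_t^{(n)})$ is $\{T_0,T_n\}_*$-conditionally Markov if for all $s\leqslant t$ in $[T_0,T_n]$, $$\mathbb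 P[I_t^{(n)}\in\cdot\mid\mathcal F_s^I]=\mathbb P[I_t^{(n)}\in\cdot\mid I^{(n)}_{T_0},\dots,I^{(n)}_{T_{m(s)}},I_s^{(n)}],\qquad m(s)=\max\{i: T_i\leqslant s\}$$ (note $I^{(n)}_{T_i}=X_i$).
   Formalization: The formal theorem additionally assumes A_1(t) ≠ 0 for all t in (T_0,T_n)_*; without it the claim fails, e.g. for zero noise (D_t = Z constant in t) and a signal coefficient g_1 that vanishes inside the interval after being nonzero. *)

(* Defs.v *)
From HB Require Import structures.
From mathcomp Require Import all_boot all_order all_algebra.
From mathcomp Require Import all_classical all_reals all_analysis.

Set Implicit Arguments.
Unset Strict Implicit.
Unset Printing Implicit Defensive.

Import Order.TTheory GRing.Theory Num.Theory.
Import numFieldNormedType.Exports.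

Local Open Scope classical_set_scope.
Local Open Scope ring_scope.

Section Probability.
Context {d : measure_display} {Omega : measurableType d} {R : realType}.
Variable P : probability Omega R.

Definition sigma_of {J : Type} (U : set J) (Z : J -> Omega -> R) :
    set (set Omega) :=
  <<s \bigcup_(u in U) preimage_set_system setT (Z u) measurable >>.

Definition independent_algebras (G H : set (set Omega)) : Prop :=
  forall A B, G A -> H B -> P (A `&` B) = (P A * P B)%E.

(* Degenerate normal laws are allowed; they are treated separately because
   [normal_prob m 0] is by convention the uniform law on [0, 1]. *)
Definition gaussian_rv (Y : Omega -> R) : Prop :=
  (exists m s : R, s != 0 /\
     forall B : set R, measurable B -> P (Y @^-1` B) = normal_prob m s B) \/
  (exists m : R,
     forall B : set R, measurable B -> P (Y @^-1` B) = \d_m B).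

(* The finite-dimensional marginals are multivariate normal: all their linear
   combinations are normal. *)
Definition gaussian_process (U : set R) (D : R -> Omega -> R) : Prop :=
  forall (k : nat) (t a : 'I_k -> R), (forall i, U (t i)) ->
    gaussian_rv (fun w => \sum_(i < k) a i * D (t i) w).

Definition process (U : set R) (D : R -> Omega -> R) : Prop :=
  forall t, U t -> measurable_fun setT (D t).

Definition sample_continuous (U : set R) (D : R -> Omega -> R) : Prop :=
  {ae P, forall w, {within U, continuous (fun t => D t w)}}.

(* [Y] is a version of the conditional probability P[E | G]. *)
Definition cond_prob_version (G : set (set Omega)) (E : set Omega)
    (Y : Omega -> R) : Prop :=
  [/\ forall B : set R, measurable B -> G (Y @^-1` B),
      P.-integrable setT (EFin \o Y)
    & forall A, G A -> (\int[P]_(w in A) (Y w)%:E = P (E `&` A))%E].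

Definition cond_prob_eq (G H : set (set Omega)) (E : set Omega) : Prop :=
  exists Y Z : Omega -> R,
    [/\ cond_prob_version G E Y, cond_prob_version H E Z
      & {ae P, forall w, Y w = Z w}].

End Probability.

(* Only the values [T 0, ..., T n] of the sequence [T] are relevant. *)
Definition dates {R : realType} (n : nat) (T : nat -> R) : Prop :=
  0 <= T 0%N /\ forall i, (i < n)%N -> T i < T i.+1.

Definition open_dates {R : realType} (n : nat) (T : nat -> R) : set R :=
  \bigcup_(i in [set i | (i < n)%N]) `]T i, T i.+1[%classic.

Definition last_date {R : realType} (n : nat) (T : nat -> R) (s : R) : nat :=
  (\max_(i < n.+1 | (T i <= s)%R) i)%N.

Definition interpolating {R : realType} (n : nat) (T : nat -> R)
    (f : 'I_n.+1 -> R -> R) : Prop :=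
  (forall i, {within `[T 0%N, T n], continuous (f i)}) /\
  (forall i j : 'I_n.+1, f i (T j) = (i == j)%:R).

Section ArcadeProcesses.
Context {d : measure_display} {Omega : measurableType d} {R : realType}.
Variables (n : nat) (T : nat -> R).
Implicit Types (D : R -> Omega -> R) (X : 'I_n.+1 -> Omega -> R).
Implicit Types (f g : 'I_n.+1 -> R -> R).

Definition signal g X (t : R) (w : Omega) : R := \sum_(i < n.+1) g i t * X i w.

Definition arcade f D (t : R) (w : Omega) : R :=
  D t w - \sum_(i < n.+1) f i t * D (T i) w.

Definition rap f g D X (t : R) (w : Omega) : R :=
  D t w - \sum_(i < n.+1) (f i t * D (T i) w - g i t * X i w).

Lemma rapE f g D X t w : rap f g D X t w = signal g X t w + arcade f D t w.
Proof. by rewrite /rap sumrB opprB addrCA. Qed.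

Definition cond_markov (P : probability Omega R) (I : R -> Omega -> R) : Prop :=
  forall (s t : R) (B : set R),
    s \in `[T 0%N, T n] -> t \in `[T 0%N, T n] -> s <= t -> measurable B ->
    cond_prob_eq P (sigma_of `[T 0%N, s] I)
      (sigma_of ([set T i | i in [set i | (i <= last_date n T s)%N]]
                   `|` [set s]) I)
      (I t @^-1` B).

End ArcadeProcesses.

(* Main.v *)
Require Import Defs.
From HB Require Import structures.
From mathcomp Require Import all_boot all_order all_algebra.
From mathcomp Require Import all_classical all_reals all_analysis.
From mathcomp Require Import measurable_realfun ring lra.

Set Implicit Arguments.
Unset Strict Implicit.
Unset Printing Implicit Defensive.

Import Order.TTheory GRing.Theory Num.Theory.
Import numFieldNormedType.Exports.

Local Open Scope classical_set_scope.
Local Open Scope ring_scope.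

(** Fix [s] and let [m] be the index of the last date not after [s]. On the open
    interval between two dates the noise has the covariance [A1 u * A2 v] for
    [u <= v], so [A u / A1 u] has uncorrelated backward increments: for
    [u <= s] the residual [Q u := A u - rho u * A s] of the linear regression of
    [A u] on [A s] is uncorrelated with [A v] for every [v >= s]. Here [rho u] is
    [A1 u / A1 s] after the date [T m] and [0] before it, different intervals
    being uncorrelated. The compatibility conditions on [g] say that the signal
    coefficients of the dates still to come obey the same proportionality,
    [g i u = rho u * g i s]. Hence, for [u <= s],
    [I u = Q u + rho u * I s + \sum_(i <= m) (g i u - rho u * g i s) * X i],
    where [X i = I (T i)]. The past of [I] up to [s] is thus generated by the
    values which the conditional Markov property allows and by the residuals
    [Q u], and the family of all residuals is independent of the signal together
    with the noise after [s], which determines both these values and [I t].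
    Information independent of all this does not change the conditional
    probability of an event on [I t].

    Independence of uncorrelated Gaussian families is obtained by testing against
    cosines. If [Y] and [Z] are uncorrelated and all their combinations are
    normal, the formula [E (cos Y) = cos (E Y) * exp (- V Y / 2)]
    ([normal_pdf_cos]) makes [E (cos Y * cos Z)] factorise
    ([uncorrelated_gaussian_cos]). Conversely an integrable variable orthogonal
    to the cosines of all affine combinations of a family has integral zero over
    every event of the sigma-algebra of that family ([cosine_test]): the weights
    which keep this orthogonality are stable under products with cosines and
    bounded limits, hence under products with indicators of half-spaces, which
    are limits of polynomials in cosines. Since
    [cos (a + b) = cos a * cos b - sin a * sin b] and a sine is a shifted cosine,
    products of cosines suffice to test the joint sigma-algebra of two families
    ([Rintegral_cos_split]). The statement on conditional probabilities is
    [cond_prob_version_enlarge]; versions exist by the Radon-Nikodym theorem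
    applied to the restriction of [P] to the smaller sigma-algebra
    ([cond_prob_version_exists]). *)

(** * Bounded factors and dominated limits *)

Section Integrals.
Context {d : measure_display} {T : measurableType d} {R : realType}.
Context {mu : {measure set T -> \bar R}}.

Lemma integrable_bounded_mul (h psi : T -> R) (C : R) :
  measurable_fun setT h -> (forall x, `|h x| <= C) ->
  mu.-integrable setT (EFin \o psi) ->
  mu.-integrable setT (EFin \o (fun x => h x * psi x)).
Proof.
move=> mh hC ipsi.
have mpsi : measurable_fun setT psi by apply/measurable_EFinP; exact: (measurable_int mu).
apply: (@le_integrable _ _ _ _ setT measurableT _ (fun x => C%:E * (psi x)%:E)%E).
- by apply/measurable_EFinP; exact: measurable_funM.
- move=> x _ /=; rewrite lee_fin !normrM ler_wpM2r//.
  exact: le_trans (hC x) (ler_norm _).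
- exact: integrableZl.
Qed.

Lemma Rintegral_dominated_cvg (F : nat -> T -> R) (f g : T -> R) :
  (forall n, measurable_fun setT (F n)) ->
  (forall x, F n x @[n --> \oo] --> f x) ->
  (forall n x, `|F n x| <= g x) ->
  mu.-integrable setT (EFin \o g) ->
  (\int[mu]_x F n x) @[n --> \oo] --> \int[mu]_x f x.
Proof.
move=> mF Ff Fg ig; apply: fine_cvg.
have mf : measurable_fun setT f.
  by apply: (measurable_fun_cvg mF) => x _; exact: Ff.
have fg x : `|f x| <= g x.
  have nFf : `|F n x| @[n --> \oo] --> `|f x| by apply: cvg_norm; exact: Ff.
  by apply: (cvgr_to_le nFf); apply: nearW => n; exact: Fg.
have intf : mu.-integrable setT (EFin \o f).
  apply: (@le_integrable _ _ _ _ setT measurableT _ (EFin \o g)) => //.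
    exact/measurable_EFinP.
  by move=> x _ /=; rewrite lee_fin (le_trans (fg x))// ler_norm.
rewrite fineK; last exact: integrable_fin_num.
apply: (@dominated_cvg _ _ _ mu setT measurableT (fun n x => (F n x)%:E) _ (EFin \o g)) => //.
- by move=> n; apply/measurable_EFinP.
- by move=> x _; apply/fine_cvgP; split; [exact: nearW|exact: Ff].
- by move=> n x _; rewrite /= lee_fin.
Qed.

Lemma Rintegral_bounded_cvg (F : nat -> T -> R) (f psi : T -> R) (C : R) :
  (forall n, measurable_fun setT (F n)) ->
  (forall n x, `|F n x| <= C) ->
  (forall x, F n x @[n --> \oo] --> f x) ->
  mu.-integrable setT (EFin \o psi) ->
  (\int[mu]_x (F n x * psi x)) @[n --> \oo] --> \int[mu]_x (f x * psi x).
Proof.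
move=> mF FC Ff ipsi.
have mpsi : measurable_fun setT psi by apply/measurable_EFinP; exact: (measurable_int mu).
apply: (@Rintegral_dominated_cvg _ _ (fun x => C * `|psi x|)).
- by move=> n; exact: measurable_funM.
- by move=> x; apply: cvgM; [exact: Ff|exact: cvg_cst].
- by move=> n x; rewrite normrM ler_wpM2r.
- rewrite [X in _.-integrable _ X](_ : _ = (fun x => C%:E * (`|psi x|)%:E)%E)//.
  by apply: integrableZl => //; exact: (integrable_norm ipsi).
Qed.

End Integrals.

(** * Polynomials approximating a step function *)

Section Step.
Context {R : realType}.
Implicit Types (r q x y : R) (n : nat).

Lemma bernoulli_ineq x n : 0 <= x -> 1 + n%:R * x <= (1 + x) ^+ n.
Proof.
move=> x0; elim: n => [|n IH]; first by rewrite mul0r addr0 expr0.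
rewrite exprS -natr1; have := ler_wpM2l (addr_ge0 ler01 x0) IH.
have : 0 <= n%:R * x * x by rewrite !mulr_ge0.
nra.
Qed.

Lemma bernoulli_ineq_sub y n : 0 <= y <= 1 -> 1 - n%:R * y <= (1 - y) ^+ n.
Proof.
move=> /andP[y0 y1]; elim: n => [|n IH]; first by rewrite mul0r subr0 expr0.
have y1' : 0 <= 1 - y by rewrite subr_ge0.
rewrite exprS -natr1; have := ler_wpM2l y1' IH.
have : 0 <= n%:R * y * y by rewrite !mulr_ge0.
nra.
Qed.

Lemma expr_sub_le_inv y n : 0 <= y <= 1 -> (1 - y) ^+ n <= (1 + n%:R * y)^-1.
Proof.
move=> /andP[y0 y1]; have y1' : 0 <= 1 - y by rewrite subr_ge0.
have p0 : 0 < 1 + n%:R * y by rewrite ltr_pwDl// mulr_ge0.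
rewrite -[leRHS]mul1r ler_pdivlMr//.
have := ler_wpM2l (exprn_ge0 n y1') (bernoulli_ineq n y0).
move=> /le_trans; apply; rewrite -exprMn exprn_ile1//; nra.
Qed.

(** With [y = (r ^ 2) ^ n] and [N = n * 4 ^ n], the product
    [N * y = n * (2 * r) ^ (2 * n)] tends to [0] for [r < 1 / 2] and to infinity
    for [r >= 1 / 2]; the factor [n] decides the borderline case [r = 1 / 2].
    Bernoulli's inequality then pins down the limit of [(1 - y) ^ N]. *)
Definition step_approx n r := (1 - (r ^+ 2) ^+ n) ^+ (n * 4 ^ n).

Lemma step_approx_bound n r : 0 <= r <= 1 -> 0 <= step_approx n r <= 1.
Proof.
move=> /andP[r0 r1]; rewrite exprn_ge0 ?exprn_ile1//= ?subr_ge0.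
- by rewrite exprn_ile1 ?exprn_ge0// exprn_ile1.
- by rewrite gerBl !exprn_ge0.
- by rewrite exprn_ile1 ?exprn_ge0// exprn_ile1.
Qed.

Lemma step_approx_cvg r : 0 <= r <= 1 ->
  (step_approx n r @[n --> \oo]) --> ((r < 1 / 2)%R%:R : R).
Proof.
move=> r01; have /andP[r0 r1] := r01; pose q := 2 * r.
have q0 : 0 <= q by rewrite mulr_ge0.
have y01 n : 0 <= (r ^+ 2) ^+ n <= 1.
  by rewrite !exprn_ge0//= exprn_ile1 ?exprn_ge0// exprn_ile1.
have NyE n : (n * 4 ^ n)%:R * (r ^+ 2) ^+ n = n%:R * (q ^+ n * q ^+ n) :> R.
  rewrite natrM natrX -mulrA -!exprMn; congr (_ * _ ^+ _).
  by rewrite /q; ring.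
have [rlt|rge] := ltP r (1 / 2).
- have q1 : q < 1 by rewrite /q; lra.
  have [C nqC] : exists C, forall n, n%:R * q ^+ n <= C.
    have [q_eq0|q_neq0] := eqVneq q 0.
      exists 0 => -[|n]; first by rewrite mul0r.
      by rewrite q_eq0 expr0n mulr0.
    have qgt0 : 0 < q by rewrite lt_def q_neq0.
    pose e := q^-1 - 1; have e0 : 0 < e by rewrite subr_gt0 invf_gt1.
    exists e^-1 => n; rewrite -ler_pdivlMr ?exprn_gt0// -exprVn mulrC.
    have -> : q^-1 = 1 + e by rewrite /e; ring.
    rewrite ler_pdivlMr//.
    apply: le_trans (bernoulli_ineq n (ltW e0)).
    by rewrite lerDr.
  apply: (@squeeze_cvgr _ _ _ _ (fun n => 1 - C * q ^+ n) (cst 1)).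
  + apply: nearW => n; apply/andP; split; last first.
      by have /andP[] := step_approx_bound n r01.
    apply: le_trans (bernoulli_ineq_sub _ (y01 n)).
    by rewrite lerD2l lerN2 NyE mulrA ler_wpM2r ?exprn_ge0.
  + rewrite -[X in _ --> X]subr0; apply: cvgB; first exact: cvg_cst.
    apply: (@cvg_geometric R C q).
    by rewrite ger0_norm.
  + exact: cvg_cst.
- have q1 : 1 <= q by rewrite /q; lra.
  apply: (@squeeze_cvgr _ _ _ _ (cst 0) harmonic).
  + apply: nearW => n; apply/andP; split.
      by have /andP[] := step_approx_bound n r01.
    apply: le_trans (expr_sub_le_inv _ (y01 n)) _.
    rewrite /harmonic /= lef_pV2 ?posrE ?ltr0Sn//; last first.
      by rewrite NyE ltr_pwDl// !mulr_ge0// exprn_ge0.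
    rewrite -natr1 addrC lerD2l NyE ler_peMr//.
    by rewrite mulr_ege1 ?exprn_ege1.
  + exact: cvg_cst.
  + exact: cvg_harmonic.
Qed.

End Step.

(** * Testing a sigma-algebra with cosines *)

(** Constants belong to the span, so that a sine is the cosine of an element of
    the span and half-spaces need not pass through the origin. *)
Inductive affine_span {T : Type} {R : realType} (S : set (T -> R)) : (T -> R) -> Prop :=
| affine_span_gen Y : S Y -> affine_span S Y
| affine_span_cst c : affine_span S (fun=> c)
| affine_span_add Y Z : affine_span S Y -> affine_span S Z ->
    affine_span S (fun w => Y w + Z w)
| affine_span_scale a Y : affine_span S Y -> affine_span S (fun w => a * Y w).

Section AffineSpan.
Context {T : Type} {R : realType}.
Implicit Types (S : set (T -> R)) (Y Z : T -> R).

Lemma affine_span_sub S Y Z : affine_span S Y -> affine_span S Z ->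
  affine_span S (fun w => Y w - Z w).
Proof.
move=> SY SZ.
rewrite (_ : (fun w => _) = fun w => Y w + (-1) * Z w); last first.
  by apply/funext => w; rewrite mulN1r.
exact/affine_span_add/affine_span_scale.
Qed.

Lemma affine_span_sum S (I : Type) (s : seq I) (Y : I -> T -> R) :
  (forall i, affine_span S (Y i)) -> affine_span S (fun w => \sum_(i <- s) Y i w).
Proof.
move=> SY; elim: s => [|i s IH].
  under eq_fun do rewrite big_nil.
  exact: affine_span_cst.
under eq_fun do rewrite big_cons.
exact: affine_span_add.
Qed.

Lemma affine_span_subset S S' : S `<=` affine_span S' ->
  affine_span S `<=` affine_span S'.
Proof.
move=> SS' Y; elim=> {Y} [Y /SS'//|c|Y Z _ SY _ SZ|a Y _ SY].
- exact: affine_span_cst.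
- exact: affine_span_add.
- exact: affine_span_scale.
Qed.

End AffineSpan.

Lemma affine_span_measurable {d} {T : measurableType d} {R : realType}
    (S : set (T -> R)) Y :
  (forall Z, S Z -> measurable_fun setT Z) -> affine_span S Y ->
  measurable_fun setT Y.
Proof.
move=> mS; elim=> {Y} [Y /mS//|c|Y Z _ SY _ SZ|a Y _ SY].
- exact: measurable_cst.
- exact: measurable_funD.
- exact: measurable_funM.
Qed.

Lemma measurable_cos_comp {d} {T : measurableType d} {R : realType} (Y : T -> R) :
  measurable_fun setT Y -> measurable_fun setT (fun x => cos (Y x)).
Proof.
move=> mY; apply: (measurableT_comp _ mY).
by apply: continuous_measurable_fun; exact: continuous_cos.
Qed.

Section CosineTest.
Context {d : measure_display} {T : measurableType d} {R : realType}.
Context (P : {measure set T -> \bar R}) (S : set (T -> R)) (psi : T -> R).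
Hypothesis mS : forall Y, S Y -> measurable_fun setT Y.
Hypothesis ipsi : P.-integrable setT (EFin \o psi).

(** The weights [h] such that [h * psi] is orthogonal to the cosine of every
    affine combination. Keeping the whole family of cosines in the condition is
    what makes the class stable under products with cosines. *)
Definition cos_null (h : T -> R) : Prop :=
  [/\ measurable_fun setT h, exists C, forall x, `|h x| <= C
    & forall Y, affine_span S Y -> \int[P]_x (cos (Y x) * h x * psi x) = 0].

Let mspan Y : affine_span S Y -> measurable_fun setT Y.
Proof. exact: affine_span_measurable. Qed.

Let icos (h Y : T -> R) : measurable_fun setT h -> (exists C, forall x, `|h x| <= C) ->
  affine_span S Y ->
  P.-integrable setT (EFin \o (fun x => cos (Y x) * h x * psi x)).
Proof.
move=> mh [C hC] SY.
apply: (@integrable_bounded_mul _ _ _ _ _ _ C) => //.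
  by apply: measurable_funM => //; apply: measurable_cos_comp; exact: mspan.
move=> x; rewrite normrM -[leRHS]mul1r.
by apply: ler_pM => //; exact: cos_max.
Qed.

Lemma cos_null_lin (a b : R) (h k : T -> R) : cos_null h -> cos_null k ->
  cos_null (fun x => a * h x + b * k x).
Proof.
move=> [mh [C hC] h0] [mk [D kD] k0]; split.
- by apply: measurable_funD; apply: measurable_funM.
- exists (`|a| * C + `|b| * D) => x.
  by rewrite (le_trans (ler_normD _ _))// !normrM lerD// ler_wpM2l.
- move=> Y SY.
  have ih := icos mh (ex_intro _ C hC) SY; have ik := icos mk (ex_intro _ D kD) SY.
  transitivity (\int[P]_x (a * (cos (Y x) * h x * psi x) + b * (cos (Y x) * k x * psi x))).
    by apply: eq_Rintegral => x _; ring.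
  rewrite RintegralD//; [|exact: (integrableZl _ a ih)|exact: (integrableZl _ b ik)].
  by rewrite !RintegralZl// h0// k0// !mulr0 addr0.
Qed.

(** [2 * cos Y * cos V = cos (Y + V) + cos (Y - V)], and the span contains
    [Y + V] and [Y - V]. *)
Lemma cos_null_mul_cos h V : cos_null h -> affine_span S V ->
  cos_null (fun x => cos (V x) * h x).
Proof.
move=> [mh [C hC] h0] SV; have mV := measurable_cos_comp (mspan SV); split.
- exact: measurable_funM.
- exists C => x; rewrite normrM -[leRHS]mul1r.
  by apply: ler_pM => //; exact: cos_max.
- move=> Y SY; have SYV := affine_span_add SY SV; have SYV' := affine_span_sub SY SV.
  have i1 := icos mh (ex_intro _ C hC) SYV; have i2 := icos mh (ex_intro _ C hC) SYV'.
  transitivity (\int[P]_x (2^-1 * (cos (Y x + V x) * h x * psi x)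
                       + 2^-1 * (cos (Y x - V x) * h x * psi x))).
    by apply: eq_Rintegral => x _; rewrite cosD cosB; field.
  rewrite RintegralD//; [|exact: (integrableZl _ 2^-1 i1)|exact: (integrableZl _ 2^-1 i2)].
  rewrite !RintegralZl//; have /= -> := h0 _ SYV; have /= -> := h0 _ SYV'.
  by rewrite !mulr0 addr0.
Qed.

Lemma cos_null_lim (F : nat -> T -> R) f C : (forall n, cos_null (F n)) ->
  (forall n x, `|F n x| <= C) -> (forall x, F n x @[n --> \oo] --> f x) ->
  cos_null f.
Proof.
move=> F0 FC Ff.
have mF n : measurable_fun setT (F n) by case: (F0 n).
have fC x : `|f x| <= C.
  have nFf : `|F n x| @[n --> \oo] --> `|f x| by apply: cvg_norm; exact: Ff.
  by apply: (cvgr_to_le nFf); apply: nearW => n; exact: FC.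
split.
- by apply: (measurable_fun_cvg mF) => x _; exact: Ff.
- by exists C.
- move=> Y SY; have mY := measurable_cos_comp (mspan SY).
  have cvg_int : \int[P]_x (cos (Y x) * F n x * psi x) @[n --> \oo] -->
      \int[P]_x (cos (Y x) * f x * psi x).
    apply: (@Rintegral_bounded_cvg _ _ _ _ _ _ _ C) => //.
    + by move=> n; exact: measurable_funM.
    + move=> n x; rewrite normrM -[leRHS]mul1r.
      by apply: ler_pM => //; exact: cos_max.
    + by move=> x; apply: cvgM; [exact: cvg_cst|exact: Ff].
  rewrite -(cvg_lim _ cvg_int)//; apply: cvg_lim => //.
  rewrite (_ : (fun n => _) = cst 0); first exact: cvg_cst.
  by apply/funext => n; case: (F0 n) => _ _ ->.
Qed.

Lemma cos_null_ext h k : cos_null h -> h =1 k -> cos_null k.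
Proof. by move=> + /funext <-. Qed.

Lemma cos_null_mul_iter (r h : T -> R) n :
  (forall k, cos_null k -> cos_null (fun x => r x * k x)) ->
  cos_null h -> cos_null (fun x => r x ^+ n * h x).
Proof.
move=> rS h0; elim: n => [|n IH]; first by apply: cos_null_ext h0 _ => x; rewrite mul1r.
by apply: cos_null_ext (rS _ IH) _ => x; rewrite exprS mulrA.
Qed.

(** The indicator of [cos V < 0] is the bounded limit of the polynomials
    [step_approx n] in [r = (1 + cos V) / 2]. *)
Lemma cos_null_cos_lt0 h V : cos_null h -> affine_span S V ->
  cos_null (fun x => (cos (V x) < 0)%R%:R * h x).
Proof.
move=> h0 SV; pose r x := (1 + cos (V x)) / 2.
have r01 x : 0 <= r x <= 1.
  by rewrite /r; have := cos_max (V x); rewrite ler_norml => /andP[? ?]; lra.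
have rS k : cos_null k -> cos_null (fun x => r x * k x).
  move=> k0.
  apply: cos_null_ext (cos_null_lin 2^-1 2^-1 k0 (cos_null_mul_cos k0 SV)) _.
  by move=> x; rewrite /r; field.
have r2S n k : cos_null k -> cos_null (fun x => (1 - (r x ^+ 2) ^+ n) * k x).
  move=> k0.
  apply: cos_null_ext (cos_null_lin 1 (-1) k0 (cos_null_mul_iter (2 * n) rS k0)) _.
  by move=> x; rewrite exprM; ring.
have [_ [C hC] _] := h0.
apply: (@cos_null_lim (fun n x => step_approx n (r x) * h x) _ C).
- by move=> n; exact: (cos_null_mul_iter _ (r2S n) h0).
- move=> n x; rewrite normrM -[leRHS]mul1r; apply: ler_pM => //.
  by have /andP[? ?] := step_approx_bound n (r01 x); rewrite ger0_norm.
- move=> x; apply: cvgM; last exact: cvg_cst.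
  have := step_approx_cvg (r01 x).
  rewrite (_ : (r x < 1 / 2) = (cos (V x) < 0))//.
  by rewrite /r; apply/idP/idP; lra.
Qed.

(** For [n > |V|] the angle [V / n] lies in the interval where its sine has the
    sign of [V], and the sine is minus the cosine of [V / n + pi / 2]. *)
Lemma cos_null_gt0 h V : cos_null h -> affine_span S V ->
  cos_null (fun x => (0 < V x)%R%:R * h x).
Proof.
move=> h0 SV; have [_ [C hC] _] := h0.
pose W n x := n.+1%:R^-1 * V x + pi / 2.
have SW n : affine_span S (W n).
  by apply: affine_span_add (affine_span_cst _ _); exact: affine_span_scale.
apply: (@cos_null_lim (fun n x => (cos (W n x) < 0)%R%:R * h x) _ C).
- by move=> n; exact: cos_null_cos_lt0.
- move=> n x; rewrite normrM -[leRHS]mul1r; apply: ler_pM => //.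
  by case: ltP; rewrite ?normr1 ?normr0.
- move=> x; apply: cvgM; last exact: cvg_cst.
  apply: cvg_near_cst.
  have : \forall n \near \oo, `|V x| < n.+1%:R.
    have := @nbhs_infty_gtr R `|V x|; apply: filterS => n /lt_trans; apply.
    by rewrite ltr_nat.
  apply: filterS => n Vn.
  rewrite /W cosDpihalf oppr_lt0.
  have n0 : 0 < n.+1%:R :> R by [].
  have Vpi : `|n.+1%:R^-1 * V x| < pi.
    rewrite normrM gtr0_norm ?invr_gt0// mulrC ltr_pdivrMr//.
    apply: lt_le_trans Vn _; rewrite ler_peMl//.
    by apply: le_trans (pi_ge2 R); lra.
  have [V0|V0] := ltP 0 (V x).
    rewrite sin_gt0_pi// mulr_gt0 ?invr_gt0//=.
    by apply: le_lt_trans Vpi; exact: ler_norm.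
  rewrite ltNge -oppr_ge0 -sinN sin_ge0_pi// oppr_ge0 mulr_ge0_le0 ?invr_ge0//=.
  by apply/ltW; apply: le_lt_trans Vpi; rewrite -normrN; exact: ler_norm.
Qed.

End CosineTest.

Lemma sigma_of_measurable {d} {T : measurableType d} {R : realType} {J : Type}
    (U : set J) (Z : J -> T -> R) :
  (forall u, U u -> measurable_fun setT (Z u)) -> sigma_of U Z `<=` measurable.
Proof.
move=> mZ; apply: smallest_sub; first exact: sigma_algebra_measurable.
by move=> _ [u Uu [B mB <-]]; exact: mZ.
Qed.

Section CosineTestSigma.
Context {d : measure_display} {T : measurableType d} {R : realType} {J : Type}.
Context (P : {measure set T -> \bar R}) (U : set J) (Z : J -> T -> R).
Context (psi : T -> R).
Hypothesis mZ : forall u, U u -> measurable_fun setT (Z u).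
Hypothesis ipsi : P.-integrable setT (EFin \o psi).

Let S := Z @` U.
Let mS Y : S Y -> measurable_fun setT Y.
Proof. by move=> [u Uu <-]; exact: mZ. Qed.

Let null := cos_null P S psi.

(** The events by whose indicators the class [cos_null] can be multiplied. They
    form a sigma-algebra, which dispenses with any argument on pi-systems. *)
Definition cos_null_set : set (set T) :=
  [set A | forall h, null h -> null (fun x => \1_A x * h x)].

Lemma cos_null_setC A : cos_null_set A -> cos_null_set (~` A).
Proof.
move=> nA h h0; apply: cos_null_ext (cos_null_lin mS ipsi 1 (-1) h0 (nA _ h0)) _.
by move=> x; rewrite !indicE in_setC; case: (x \in A) => /=; ring.
Qed.

Lemma cos_null_setU A B : cos_null_set A -> cos_null_set B -> cos_null_set (A `|` B).
Proof.
move=> nA nB h h0.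
have := cos_null_lin mS ipsi 1 (-1) h0 (nA _ h0) => /nB.
move=> /(cos_null_lin mS ipsi 1 1 (nA _ h0)) /cos_null_ext; apply.
by move=> x; rewrite !indicE in_setU; case: (x \in A); case: (x \in B) => /=; ring.
Qed.

Lemma cos_null_set_sigma_algebra : sigma_algebra setT cos_null_set.
Proof.
have n0 : cos_null_set set0.
  move=> h h0; apply: cos_null_ext (cos_null_lin mS ipsi 0 0 h0 h0) _.
  by move=> x; rewrite indicE in_set0 /=; ring.
split => //.
- by move=> A nA; rewrite setTD; exact: cos_null_setC.
- move=> F nF h h0; have [_ [C hC] _] := h0.
  pose A n := \big[setU/set0]_(k < n) F k.
  have nA n : cos_null_set (A n).
    rewrite /A; elim: n => [|n IH]; first by rewrite big_ord0.
    by rewrite big_ord_recr; exact: cos_null_setU.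
  apply: (@cos_null_lim _ _ _ _ _ _ mS ipsi (fun n x => \1_(A n) x * h x) _ C).
  + by move=> n; exact: nA.
  + move=> n x; rewrite normrM -[leRHS]mul1r; apply: ler_pM => //.
    by rewrite indicE; case: (_ \in _); rewrite ?normr1 ?normr0.
  + move=> x; apply: cvgM; last exact: cvg_cst.
    apply: cvg_near_cst; rewrite !indicE.
    have [[k _ Fkx]|nFx] := pselect ((\bigcup_k F k) x).
      exists k.+1 => // n /= kn; congr (_ %:R).
      rewrite !mem_set//; first by exists k.
      by rewrite /A -bigcup_mkord; exists k.
    apply: nearW => n; rewrite (memNset nFx) indicE memNset//.
    by rewrite /A -bigcup_mkord => -[k _ Fkx]; apply: nFx; exists k.
Qed.

Lemma cos_null_set_sub : sigma_of U Z `<=` cos_null_set.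
Proof.
apply: smallest_sub; first exact: cos_null_set_sigma_algebra.
move=> _ [u Uu [B mB <-]].
have : preimage_set_system setT (Z u) measurable `<=` cos_null_set; last first.
  by apply; exists B.
have -> : (measurable : set (set R)) = (@RGenOInfty.G R).-sigma.-measurable.
  exact: RGenOInfty.measurableE.
rewrite -g_sigma_preimageE.
apply: smallest_sub; first exact: cos_null_set_sigma_algebra.
move=> _ [_ [b ->] <-] h h0.
have SV : affine_span S (fun x => Z u x - b).
  by apply: affine_span_sub (affine_span_cst _ _); apply: affine_span_gen; exists u.
apply: cos_null_ext (cos_null_gt0 mS ipsi h0 SV) _ => x.
rewrite indicE setTI; congr (_%:R * _); congr nat_of_bool.
by apply/idP/idP; rewrite inE /= in_itv /= andbT subr_gt0.
Qed.

(** The half-spaces [Z u > b] belong to the sigma-algebra [cos_null_set], hence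
    so does all of [sigma_of U Z]. The hypothesis says that the weight [1] is in
    [cos_null], and the cosine of the null combination is [1]. *)
Lemma cosine_test : (forall Y, affine_span S Y -> \int[P]_x (cos (Y x) * psi x) = 0) ->
  forall A, sigma_of U Z A -> \int[P]_(x in A) psi x = 0.
Proof.
move=> psi0 A UA.
have n1 : null (cst 1).
  split => //; first by exists 1 => x; rewrite normr1.
  by move=> Y SY; rewrite -[RHS](psi0 _ SY); apply: eq_Rintegral => x _; rewrite mulr1.
have [_ _ /(_ _ (affine_span_cst _ 0)) psiA] := cos_null_set_sub UA n1.
rewrite Rintegral_mkcond -[RHS]psiA; apply: eq_Rintegral => x _.
by rewrite cos0 mul1r /= mulr1 patchE indicE; case: (x \in A); rewrite ?mul1r ?mul0r.
Qed.

End CosineTestSigma.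

(** * Orthogonality to a sigma-algebra *)

Section StaircaseApproximation.
Context {R : realType}.
Implicit Types (y z : R) (n m : nat).

(** For [0 <= y <= m] this is the integer part of [y], written as a finite sum of
    indicators of half-lines. *)
Definition count_below m y : R := \sum_(k < m) (k.+1%:R <= y)%R%:R.

Lemma count_below_le m y : 0 <= y -> count_below m y <= y.
Proof.
move=> y0; rewrite /count_below; elim: m => [|m IH]; first by rewrite big_ord0.
rewrite big_ord_recr /=; case: (leP m.+1%:R y) => [my|_]; last by rewrite addr0.
apply: le_trans my; rewrite -natr1 lerD2r.
rewrite -[leRHS](_ : \sum_(k < m) 1 = _); last by rewrite sumr_const card_ord.
by apply: ler_sum => k _; case: (k.+1%:R <= y); rewrite ?lexx ?ler01.
Qed.

Lemma count_below_ge0 m y : 0 <= count_below m y.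
Proof. exact: sumr_ge0. Qed.

Lemma count_below_neg m y : y <= 0 -> count_below m y = 0.
Proof.
move=> y0; apply: big1 => k _.
by rewrite leNgt (le_lt_trans y0).
Qed.

Lemma count_below_ge m y : 0 <= y -> y <= m%:R -> y - 1 <= count_below m y.
Proof.
move=> y0 ym.
suff [//|[-> _]] : y - 1 <= count_below m y \/ count_below m y = m%:R /\ m%:R <= y.
  by lra.
rewrite /count_below; elim: m {ym} => [|m [IH|[IH my]]].
- by right; rewrite big_ord0.
- by left; rewrite big_ord_recr /= (le_trans IH)// lerDl.
- rewrite big_ord_recr /= IH; case: (leP m.+1%:R y) => [my1|my1].
    by right; rewrite /= natr1.
  by left; rewrite /= addr0; move: my1; rewrite -natr1; lra.
Qed.

Definition staircase n z : R :=
  n.+1%:R^-1 * (count_below (n.+1 * n.+1) (n.+1%:R * z)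
              - count_below (n.+1 * n.+1) (n.+1%:R * - z)).

Lemma staircaseN n z : staircase n (- z) = - staircase n z.
Proof. by rewrite /staircase opprK -mulrN opprB. Qed.

Lemma staircase_ge0E n z : 0 <= z ->
  staircase n z = n.+1%:R^-1 * count_below (n.+1 * n.+1) (n.+1%:R * z).
Proof.
move=> z0; rewrite /staircase [X in _ - X]count_below_neg ?subr0//.
by rewrite mulrN oppr_le0 mulr_ge0.
Qed.

Lemma staircase_norm_le n z : `|staircase n z| <= `|z|.
Proof.
wlog z0 : z / 0 <= z.
  move=> H; have [/H//|z0] := leP 0 z.
  by rewrite -[z]opprK staircaseN normrN [leRHS]normrN H// oppr_ge0 ltW.
rewrite staircase_ge0E// normrM ger0_norm ?invr_ge0// !ger0_norm ?count_below_ge0//.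
by rewrite mulrC ler_pdivrMr// mulrC count_below_le// mulr_ge0.
Qed.

Lemma staircase_cvg z : staircase n z @[n --> \oo] --> z.
Proof.
suff : forall z, 0 <= z -> staircase n z @[n --> \oo] --> z.
  move=> H; have [/H//|z0] := leP 0 z.
  have Nz0 : 0 <= - z by rewrite oppr_ge0 ltW.
  rewrite -[z]opprK.
  under eq_fun do rewrite staircaseN.
  by apply: (@cvgN _ R^o); exact: H.
move=> {}z z0.
apply: (@squeeze_cvgr _ _ _ _ (fun n => z - harmonic n) (cst z)); last 2 first.
- by rewrite -[X in _ --> X]subr0; apply: cvgB; [exact: cvg_cst|exact: cvg_harmonic].
- exact: cvg_cst.
near=> n; apply/andP; split; last first.
  by rewrite (le_trans (ler_norm _))// (le_trans (staircase_norm_le _ _))// ger0_norm.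
have n0 : 0 < n.+1%:R :> R by [].
rewrite staircase_ge0E// /harmonic /= mulrC ler_pdivlMr//.
rewrite mulrBl mulVf ?gt_eqF// mulrC count_below_ge ?mulr_ge0//.
rewrite natrM ler_pM2l//; apply: (@le_trans _ _ n%:R); last by rewrite ler_nat.
by near: n; apply: nbhs_infty_ger.
Unshelve. all: end_near. Qed.

End StaircaseApproximation.

Section Orthogonality.
Context {d : measure_display} {T : measurableType d} {R : realType}.
Context (P : {measure set T -> \bar R}).

(** [staircase n (Z x)] is a finite combination of indicators of events of [G],
    dominated by [Z] and converging to it, so dominated convergence applies. *)
Lemma Rintegral_mul_null (G : set (set T)) (Z h : T -> R) :
  G `<=` measurable -> (forall A, G A -> \int[P]_(x in A) h x = 0) ->
  P.-integrable setT (EFin \o h) ->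
  (forall B : set R, measurable B -> G (Z @^-1` B)) ->
  P.-integrable setT (EFin \o (fun x => Z x * h x)) ->
  \int[P]_x (Z x * h x) = 0.
Proof.
move=> mG h0 ih GZ iZh.
have mh : measurable_fun setT h by apply/measurable_EFinP; exact: (measurable_int P).
pose null (V : T -> R) := [/\ measurable_fun setT V,
  P.-integrable setT (EFin \o (fun x => V x * h x)) & \int[P]_x (V x * h x) = 0].
have null_ext V W : null V -> V =1 W -> null W by move=> + /funext <-.
have null_lin a b V W : null V -> null W -> null (fun x => a * V x + b * W x).
  move=> [mV iV V0] [mW iW W0].
  have E : (fun x => (a * V x + b * W x) * h x) =
      fun x => a * (V x * h x) + b * (W x * h x).
    by apply/funext => x; ring.
  split.
  - by apply: measurable_funD; apply: measurable_funM.
  - rewrite E; apply: (@integrableD _ _ _ P setT measurableT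
      (EFin \o (fun x => a * (V x * h x))) (EFin \o (fun x => b * (W x * h x)))).
      exact: (integrableZl _ a iV).
    exact: (integrableZl _ b iW).
  - rewrite E RintegralD//; [|exact: (integrableZl _ a iV)|exact: (integrableZl _ b iW)].
    by rewrite !RintegralZl// V0 W0 !mulr0 addr0.
have null_indic A : G A -> null (fun x => (x \in A)%:R).
  move=> GA; have mA := mG _ GA; have m1 : measurable_fun setT (\1_A : T -> R) by [].
  split => //.
  - apply: (integrable_bounded_mul (C := 1)) => // x.
    by case: (_ \in _); rewrite ?normr1 ?normr0.
  - rewrite -[RHS](h0 _ GA) [RHS]Rintegral_mkcond; apply: eq_Rintegral => x _.
    by rewrite patchE; case: (_ \in _); rewrite ?mul1r ?mul0r.
have null_count m (V : T -> R) : (forall y, G [set x | y <= V x]) ->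
    null (fun x => count_below m (V x)).
  move=> GV; rewrite /count_below; elim: m => [|m [mI iI I0]].
    apply: null_ext (null_lin 0 0 _ _ (null_indic _ (GV 0)) (null_indic _ (GV 0))) _.
    by move=> x; rewrite big_ord0; ring.
  apply: null_ext (null_lin 1 1 _ _ (And3 mI iI I0) (null_indic _ (GV m.+1%:R))) _.
  move=> x; rewrite big_ord_recr/= !mul1r; congr (_ + _%:R).
  by congr nat_of_bool; apply/idP/idP; rewrite inE.
have null_staircase n : null (fun x => staircase n (Z x)).
  have n0 : 0 < n.+1%:R :> R by [].
  have G1 y : G [set x | y <= n.+1%:R * Z x].
    rewrite (_ : [set x | _] = Z @^-1` `[y / n.+1%:R, +oo[); first exact: GZ.
    by apply/seteqP; split => x /=; rewrite in_itv/= andbT ler_pdivrMr// mulrC.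
  have G2 y : G [set x | y <= n.+1%:R * - Z x].
    rewrite (_ : [set x | _] = Z @^-1` `]-oo, - (y / n.+1%:R)]); first exact: GZ.
    by apply/seteqP; split => x /=; rewrite in_itv/= lerNr ler_pdivrMr// mulrC.
  apply: null_ext (null_lin n.+1%:R^-1 (- n.+1%:R^-1) _ _ (null_count _ _ G1)
    (null_count _ _ G2)) _.
  by move=> x; rewrite /staircase; ring.
have cvg_int : \int[P]_x (staircase n (Z x) * h x) @[n --> \oo] --> \int[P]_x (Z x * h x).
  apply: (Rintegral_dominated_cvg (g := fun x => `|Z x * h x|)).
  - by move=> n; apply: measurable_funM => //; case: (null_staircase n).
  - by move=> x; apply: cvgM; [exact: staircase_cvg|exact: cvg_cst].
  - by move=> n x; rewrite normrM [leRHS]normrM ler_wpM2r// staircase_norm_le.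
  - exact: (integrable_norm iZh).
rewrite -(cvg_lim _ cvg_int)//; apply: cvg_lim => //.
rewrite (_ : (fun n => _) = cst 0); first exact: cvg_cst.
by apply/funext => n; case: (null_staircase n).
Qed.

End Orthogonality.

(** * The cosine transform of the normal law *)

Section DerivativeIntegral.
Context {R : realType}.
Local Notation leb := (@lebesgue_measure R).

(** By the fundamental theorem of calculus the integral over
    [[m - n, m + n]] is a difference of two values of [F] at distance [n] from
    [m], each bounded by [C / n]. *)
Lemma Rintegral_derivative_eq0 (F f : R -> R) (m C : R) :
  (forall x : R, is_derive x (1 : R) F (f x)) -> continuous f ->
  leb.-integrable setT (EFin \o f) -> (forall x, `|x - m| * `|F x| <= C) ->
  \int[leb]_x f x = 0.
Proof.
move=> dF cf intf FC.
have mf : measurable_fun setT f by exact: continuous_measurable_fun.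
pose a n : R := m - n.+1%:R; pose b n : R := m + n.+1%:R.
pose I n : set R := `[a n, b n]%classic.
have n0 n : 0 < n.+1%:R :> R by [].
have cF : continuous F.
  by move=> x; apply: differentiable_continuous; apply/derivable1_diffP; case: (dF x).
have ftc n : \int[leb]_(x in I n) f x = F (b n) - F (a n).
  rewrite /Rintegral (@continuous_FTC2 _ f F)//.
  - by rewrite /a /b; have := n0 n; lra.
  - exact: continuous_subspaceT.
  - split => [x _||]; first by case: (dF x).
    + by apply: cvg_at_right_filter; exact: cF.
    + by apply: cvg_at_left_filter; exact: cF.
  - by move=> x _; rewrite derive1E; case: (dF x).
have lim0 : \int[leb]_(x in I n) f x @[n --> \oo] --> (0 : R).
  under eq_fun do rewrite ftc.
  have bnd y n : `|y - m| = n.+1%:R -> `|F y| <= C * harmonic n.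
    move=> ym; have := FC y; rewrite ym /harmonic /= => Fy.
    by rewrite ler_pdivlMr// mulrC.
  have C0 : C * harmonic n @[n --> \oo] --> (0 : R).
    by rewrite -[X in _ --> X](mulr0 C); apply: cvgM; [exact: cvg_cst|exact: cvg_harmonic].
  apply: (@squeeze_cvgr _ _ _ _ (fun n => - (C * harmonic n + C * harmonic n))
           (fun n => C * harmonic n + C * harmonic n)).
  - apply: nearW => n; rewrite -ler_norml (le_trans (ler_normB _ _))// lerD// bnd//.
      by rewrite /b addrC addKr gtr0_norm.
    by rewrite /a addrC addKr normrN gtr0_norm.
  - by rewrite -oppr0 -[X in - X]addr0; apply: (@cvgN _ R^o); exact: cvgD.
  - by rewrite -[X in _ --> X]addr0; exact: cvgD.
have limf : \int[leb]_(x in I n) f x @[n --> \oo] --> \int[leb]_x f x.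
  under eq_fun do rewrite Rintegral_mkcond.
  apply: (@Rintegral_dominated_cvg _ _ _ leb (fun n => f \_ (I n)) f (fun x => `|f x|)).
  - move=> n; apply/(measurable_restrictT f (measurable_itv _)).
    exact: measurable_funTS.
  - move=> x; apply: cvg_near_cst.
    have : \forall n \near \oo, `|x - m| < n.+1%:R.
      have := @nbhs_infty_gtr R `|x - m|; apply: filterS => n /lt_trans; apply.
      by rewrite ltr_nat.
    apply: filterS => n; rewrite ltr_norml => /andP[? ?].
    by rewrite patchE mem_set// /I /= in_itv /= /a /b; apply/andP; split; lra.
  - by move=> n x; rewrite patchE; case: (_ \in _); rewrite ?normr0.
  - exact: (integrable_norm intf).
by rewrite -(cvg_lim _ limf)//; exact: cvg_lim.
Qed.

End DerivativeIntegral.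

Section NormalIntegrals.
Context {R : realType}.
Context (m s : R).
Hypothesis s0 : s != 0.
Local Notation leb := (@lebesgue_measure R).
Local Notation p := (normal_pdf m s).

Let s2_gt0 : 0 < s ^+ 2.
Proof. by rewrite exprn_even_gt0. Qed.

Lemma is_derive_affine (a b x : R) : is_derive x (1 : R) (fun y => a * (y - m) + b) a.
Proof.
have dB := is_deriveB (is_derive_id x (1 : R)) (is_derive_cst m x (1 : R)).
have d1 := is_deriveD (is_deriveZ a dB) (is_derive_cst b x (1 : R)).
by apply: is_derive_eq; rewrite subr0 addr0 /GRing.scale /= mulr1.
Qed.

Lemma is_derive_normal_pdf (x : R) :
  is_derive x (1 : R) p (- ((x - m) / s ^+ 2) * p x).
Proof.
rewrite (normal_pdfE _ s0).
have sq y : ((@id R - cst m) ^+ 2) y = (y - m) ^+ 2 by [].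
have E : (fun x => normal_peak s * normal_fun m s x) =
  (normal_peak s *: (expR \o (- (s ^+ 2 *+ 2)^-1 *: ((@id R - cst m) ^+ 2) : R -> R))).
  apply/funext => y; rewrite /normal_fun; congr (_ * expR _).
  by rewrite -[RHS]/(- (s ^+ 2 *+ 2)^-1 * ((@id R - cst m) ^+ 2) y) sq !mulNr mulrC.
rewrite E; apply: is_derive_eq; rewrite /GRing.scale /=.
rewrite sq.
rewrite -[(id - cst m) x]/(x - m) /normal_fun.
rewrite (_ : - (x - m) ^+ 2 / (s ^+ 2 *+ 2) = - (s ^+ 2 *+ 2)^-1 * (x - m) ^+ 2); last first.
  by rewrite !mulNr mulrC.
by rewrite -(mulr_natr (s ^+ 2)); field; rewrite s0.
Qed.

Lemma normal_pdf_expE x : p x = normal_peak s * expR (- ((x - m) ^+ 2 / (s ^+ 2 *+ 2))).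
Proof. by rewrite normal_pdfE// /normal_fun mulNr. Qed.

Lemma sqr_normal_pdf_le x : (x - m) ^+ 2 * p x <= 2 * s ^+ 2 * normal_peak s.
Proof.
rewrite normal_pdf_expE; set t := (x - m) ^+ 2.
have t0 : 0 <= t by exact: sqr_ge0.
have := expR_ge1Dx (t / (s ^+ 2 *+ 2)).
rewrite expRN; set e := expR _ => te; have e0 : 0 < e by exact: expR_gt0.
rewrite mulrCA mulrC ler_wpM2r ?normal_peak_ge0//.
rewrite ler_pdivrMr//.
have : t / (s ^+ 2 *+ 2) <= e by apply: le_trans te; rewrite lerDr.
by rewrite ler_pdivrMr ?pmulrn_lgt0// -mulr_natr => /le_trans; apply; rewrite mulrC [2 * _]mulrC.
Qed.

(** Half of the exponential absorbs the square, since [y * exp (- y) <= 1]; what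
    remains is a normal density of twice the variance, which is integrable. *)
Lemma sqr_normal_pdf_le_pdf : exists C, forall x,
  (x - m) ^+ 2 * p x <= C * normal_pdf m (Num.sqrt 2 * s) x.
Proof.
pose s' := Num.sqrt 2 * s.
have s'2 : s' ^+ 2 = 2 * s ^+ 2 by rewrite exprMn sqr_sqrtr.
have s'0 : s' != 0 by rewrite mulf_neq0// gt_eqF// sqrtr_gt0.
have k'0 := normal_peak_gt0 s'0.
exists (4 * s ^+ 2 * normal_peak s / normal_peak s') => x.
rewrite normal_pdf_expE normal_pdfE// -/s' /normal_fun mulNr s'2.
set t := (x - m) ^+ 2.
have t0 : 0 <= t by exact: sqr_ge0.
have -> : t / (2 * s ^+ 2 *+ 2) = t / (4 * s ^+ 2).
  by congr (_ / _); rewrite -mulr_natr; ring.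
have -> : t / (s ^+ 2 *+ 2) = t / (4 * s ^+ 2) + t / (4 * s ^+ 2).
  by rewrite -(mulr_natr (s ^+ 2)); field.
rewrite opprD expRD expRN; set e := expR _.
have e0 : 0 < e by exact: expR_gt0.
have te : t <= 4 * s ^+ 2 * e.
  have s4 : 0 < 4 * s ^+ 2 by exact: mulr_gt0.
  rewrite mulrC -ler_pdivrMr//.
  by apply: le_trans (expR_ge1Dx _); rewrite lerDr.
rewrite (_ : _ * (normal_peak s' * _) = normal_peak s / e * (4 * s ^+ 2)); last first.
  by field; rewrite !gt_eqF.
rewrite (_ : t * _ = normal_peak s / e * (t / e)); last by field; rewrite gt_eqF.
by rewrite ler_wpM2l ?ler_pdivrMr// divr_ge0 ?normal_peak_ge0// ltW.
Qed.

Lemma integrable_sqr_normal_pdf :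
  leb.-integrable setT (EFin \o (fun x => (x - m) ^+ 2 * p x)).
Proof.
have [C HC] := sqr_normal_pdf_le_pdf.
apply: (@le_integrable _ _ _ leb setT measurableT _
  (EFin \o (fun x => C * normal_pdf m (Num.sqrt 2 * s) x))).
- apply/measurable_EFinP; apply: measurable_funM; last exact: measurable_normal_pdf.
  by apply: measurable_funX; exact: measurable_funB.
- move=> x _ /=; rewrite lee_fin ger0_norm; last by rewrite mulr_ge0 ?sqr_ge0 ?normal_pdf_ge0.
  exact: le_trans (HC x) (ler_norm _).
- exact: (integrableZl _ C (integrable_normal_pdf _ _)).
Qed.

Lemma integrable_bounded_normal_pdf (h : R -> R) (C : R) : measurable_fun setT h ->
  (forall x, `|h x| <= C * (1 + (x - m) ^+ 2)) ->
  leb.-integrable setT (EFin \o (fun x => h x * p x)).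
Proof.
move=> mh hC.
apply: (@le_integrable _ _ _ leb setT measurableT _
  (EFin \o (fun x => C * (p x + (x - m) ^+ 2 * p x)))).
- apply/measurable_EFinP; apply: measurable_funM => //; exact: measurable_normal_pdf.
- move=> x _ /=; rewrite lee_fin normrM [`|p x|]ger0_norm ?normal_pdf_ge0//.
  rewrite -[X in C * (X + _)]mul1r -mulrDl mulrA.
  apply: (le_trans _ (ler_norm _)).
  by rewrite ler_wpM2r ?normal_pdf_ge0.
- have ip : leb.-integrable setT (EFin \o (fun x => p x + (x - m) ^+ 2 * p x)).
    apply: (@integrableD _ _ _ leb setT measurableT (EFin \o p)
      (EFin \o (fun x => (x - m) ^+ 2 * p x))).
      exact: integrable_normal_pdf.
    exact: integrable_sqr_normal_pdf.
  exact: (integrableZl _ C ip).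
Qed.

End NormalIntegrals.

Lemma normr_le_add1_sqr {R : realType} (y : R) : `|y| <= 1 + y ^+ 2.
Proof. by rewrite ler_norml; apply/andP; split; nra. Qed.

Section NormalCharacteristic.
Context {R : realType}.
Context (m s : R).
Hypothesis s0 : s != 0.
Local Notation leb := (@lebesgue_measure R).
Local Notation p := (normal_pdf m s).

Let s2_gt0 : 0 < s ^+ 2.
Proof. by rewrite exprn_even_gt0. Qed.

(** The integral over the line of the derivative of [h * p] vanishes, and
    [p' = - (x - m) / s ^ 2 * p]. The moments of [p] and the differential
    equation of its cosine transform are instances. *)
Lemma stein_identity (h dh : R -> R) (C : R) :
  (forall x : R, is_derive x (1 : R) h (dh x)) -> continuous dh ->
  (forall x, `|dh x| <= C * (1 + (x - m) ^+ 2)) ->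
  (forall x, `|(x - m) * h x| <= C * (1 + (x - m) ^+ 2)) ->
  \int[leb]_x ((x - m) * h x * p x) = s ^+ 2 * \int[leb]_x (dh x * p x).
Proof.
move=> dhP cdh dhC hC.
have ch : continuous h.
  by move=> x; apply: differentiable_continuous; apply/derivable1_diffP; case: (dhP x).
have cp : continuous p by exact: continuous_normal_pdf.
have ct : continuous (fun x : R => x - m).
  by move=> x; apply: (@cvgB _ R^o); [exact: cvg_id|exact: cvg_cst].
have cth : continuous (fun x => (x - m) * h x).
  by move=> x; apply: cvgM; [exact: ct|exact: ch].
have i1 : leb.-integrable setT (EFin \o (fun x => dh x * p x)).
  by apply: (integrable_bounded_normal_pdf s0 _ dhC); exact: continuous_measurable_fun.
have i2 : leb.-integrable setT (EFin \o (fun x => (x - m) * h x * p x)).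
  by apply: (integrable_bounded_normal_pdf s0 _ hC); exact: continuous_measurable_fun.
suff : \int[leb]_x (dh x * p x - (s ^+ 2)^-1 * ((x - m) * h x * p x)) = 0.
  rewrite RintegralB//; last exact: (integrableZl _ _ i2).
  rewrite RintegralZl// => /eqP; rewrite subr_eq0 => /eqP ->.
  by rewrite mulrA mulfV ?mul1r// gt_eqF.
apply: (@Rintegral_derivative_eq0 _ (fun x => h x * p x) _ m
  (C * (normal_peak s + 2 * s ^+ 2 * normal_peak s))).
- move=> x; have dF := is_deriveM (dhP x) (is_derive_normal_pdf m s0 x).
  by apply: is_derive_eq; rewrite /GRing.scale /=; field.
- move=> x; apply: (@cvgB _ R^o); first by apply: cvgM; [exact: cdh|exact: cp].
  apply: cvgM; first exact: cvg_cst.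
  by apply: cvgM; [exact: cth|exact: cp].
- apply: (@integrableB _ _ _ leb setT measurableT (EFin \o (fun x => dh x * p x))
    (EFin \o (fun x => (s ^+ 2)^-1 * ((x - m) * h x * p x)))) => //.
  exact: (integrableZl _ _ i2).
- move=> x; rewrite normrM mulrA -normrM [`|p x|]ger0_norm ?normal_pdf_ge0//.
  have C0 : 0 <= C.
    by have := le_trans (normr_ge0 _) (hC m); rewrite subrr expr0n addr0 mulr1.
  apply: le_trans (ler_wpM2r (normal_pdf_ge0 _ _ _) (hC x)) _.
  rewrite -[leLHS]mulrA ler_wpM2l// mulrDl mul1r lerD ?normal_pdf_ub//.
  exact: sqr_normal_pdf_le.
Qed.

Lemma Rintegral_normal_pdf : \int[leb]_x p x = 1.
Proof. by rewrite /Rintegral integral_normal_pdf. Qed.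

Lemma normal_pdf_centered : \int[leb]_x ((x - m) * p x) = 0.
Proof.
transitivity (\int[leb]_x ((x - m) * cst 1 x * p x)).
  by apply: eq_Rintegral => x _ /=; rewrite mulr1.
rewrite (@stein_identity (cst 1) (cst 0) 1).
- rewrite (_ : (fun x => _) = cst 0) ?Rintegral_cst// ?mul0r ?mulr0//.
  by apply/funext => x; rewrite mul0r.
- exact: cst_continuous.
- by move=> x; rewrite normr0 mul1r addr_ge0// sqr_ge0.
- by move=> x /=; rewrite mulr1 mul1r normr_le_add1_sqr.
Qed.

Lemma normal_pdf_second_moment : \int[leb]_x ((x - m) ^+ 2 * p x) = s ^+ 2.
Proof.
transitivity (\int[leb]_x ((x - m) * (x - m) * p x)).
  by apply: eq_Rintegral => x _ /=.
have dh (x : R) : is_derive x (1 : R) (fun x => x - m) (cst 1 x).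
  have d := is_deriveB (is_derive_id x (1 : R)) (is_derive_cst m x (1 : R)).
  by apply: is_derive_eq; rewrite subr0.
rewrite (stein_identity (C := 1) dh).
- under eq_Rintegral do rewrite mul1r.
  by rewrite Rintegral_normal_pdf mulr1.
- exact: cst_continuous.
- by move=> x; rewrite normr1 mul1r lerDl sqr_ge0.
- by move=> x /=; rewrite mul1r -expr2 ger0_norm ?sqr_ge0// lerDr.
Qed.

Let charF (b k : R) : R := \int[leb]_x (cos (k * (x - m) + b) * p x).

Let ccos (k b : R) : continuous (fun x => cos (k * (x - m) + b)).
Proof.
move=> x; apply: (continuous_comp (f := fun x => k * (x - m) + b)); last exact: continuous_cos.
apply: differentiable_continuous; apply/derivable1_diffP.
by case: (is_derive_affine m k b x).
Qed.

Let is_derive_charF b k : is_derive k (1 : R) (charF b) (- s ^+ 2 * k * charF b k).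
Proof.
pose F (k x : R) := cos (k * (x - m) + b) * p x.
pose G (x : R) := `|x - m| * p x.
have dF l x : is_derive l (1 : R) (F ^~ x) (- (x - m) * sin (l * (x - m) + b) * p x).
  have dB := is_deriveD (is_deriveZ (x - m) (is_derive_id l (1 : R))) (is_derive_cst b l (1 : R)).
  have dc := is_deriveZ (p x) (is_derive1_comp (is_derive_cos _) dB).
  have E : F^~ x = p x *: (@cos R \o ((x - m) *: (@id R) + cst b : R -> R)).
    apply/funext => y; rewrite /F mulrC; congr (_ * cos (_ + _)).
    by rewrite mulrC.
  rewrite E; apply: is_derive_eq; rewrite /GRing.scale /= addr0.
  have -> : ((x - m) *: (@id R) + cst b : R -> R) l = l * (x - m) + b.
    by rewrite mulrC.
  by ring.
have iF l : leb.-integrable setT (EFin \o F l).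
  apply: (integrable_bounded_normal_pdf (C := 1) s0).
    exact: (continuous_measurable_fun (@ccos l b)).
  by move=> x; rewrite mul1r (le_trans (cos_max _))// lerDl sqr_ge0.
have iG : leb.-integrable setT (EFin \o G).
  apply: (integrable_bounded_normal_pdf (C := 1) s0).
    by apply: measurableT_comp => //; exact: measurable_funB.
  by move=> x; rewrite mul1r normr_id normr_le_add1_sqr.
have G0 x : 0 <= G x by rewrite /G mulr_ge0// normal_pdf_ge0.
have pF l x : partial1of2 F l x = - (x - m) * sin (l * (x - m) + b) * p x.
  by rewrite partial1of2E; case: (dF l x).
have FG l x : `|partial1of2 F l x| <= G x.
  rewrite pF !normrM normrN [`|p x|]ger0_norm ?normal_pdf_ge0//.
  by rewrite ler_wpM2r ?normal_pdf_ge0// -[leRHS]mulr1 ler_wpM2l// sin_max.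
have kI : (`]k - 1, k + 1[%classic : set R) k by rewrite /= in_itv/=; apply/andP; split; lra.
have dF' l x : `]k - 1, k + 1[%classic l -> setT x -> derivable (F^~ x) l 1.
  by move=> _ _; case: (dF l x).
have dcharF : derivable (charF b) k 1.
  exact: (@derivable_under_integral _ _ _ leb F setT measurableT k _ _ kI
    (fun l _ => iF l) dF' G G0 iG (fun l x _ _ => FG l x)).
apply: DeriveDef => //.
rewrite -derive1E (@differentiation_under_integral _ _ _ leb F setT measurableT k _ _ kI
    (fun l _ => iF l) dF' G G0 iG (fun l x _ _ => FG l x)).
under eq_Rintegral do rewrite pF.
transitivity (\int[leb]_x (- 1 * ((x - m) * sin (k * (x - m) + b) * p x))).
  by apply: eq_Rintegral => x _; ring.
have dsin x : is_derive x (1 : R) (fun x => sin (k * (x - m) + b)) (k * cos (k * (x - m) + b)).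
  have ds := is_derive1_comp (is_derive_sin _) (is_derive_affine m k b x).
  by apply: is_derive_eq; rewrite mulrC.
have csin : continuous (fun x => sin (k * (x - m) + b)).
  by move=> x; apply: differentiable_continuous; apply/derivable1_diffP; case: (dsin x).
rewrite RintegralZl//; last first.
  apply: (integrable_bounded_normal_pdf (C := 1) s0).
    apply: measurable_funM; first exact: measurable_funB.
    exact: (continuous_measurable_fun csin).
  move=> x; rewrite mul1r normrM (le_trans _ (normr_le_add1_sqr _))//.
  by rewrite -[leRHS]mulr1 ler_wpM2l// sin_max.
rewrite (stein_identity (C := 1 + `|k|) dsin)//.
- rewrite (_ : \int[leb]_x _ = k * charF b k); first by ring.
  rewrite -RintegralZl//; last exact: iF.
  by apply: eq_Rintegral => x _; rewrite mulrA.
- by move=> x; apply: cvgM; [exact: cvg_cst|exact: ccos].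
- move=> x; rewrite normrM ler_pM//; first by rewrite lerDr.
  by rewrite (le_trans (cos_max _))// lerDl sqr_ge0.
- move=> x; rewrite normrM.
  have /le_trans -> // := ler_wpM2l (normr_ge0 (x - m)) (sin_max (k * (x - m) + b)).
  rewrite mulr1 (le_trans (normr_le_add1_sqr _))// ler_peMl ?lerDl//.
  by rewrite addr_ge0// sqr_ge0.
Qed.

(** As a function of [k], the integral of [cos (k * (x - m) + m + b) * p x] has
    derivative [- s ^ 2 * k] times itself by [stein_identity], hence it is
    [cos (m + b) * exp (- s ^ 2 * k ^ 2 / 2)]; take [k = 1]. *)
Lemma normal_pdf_cos (b : R) :
  \int[leb]_x (cos (x + b) * p x) = cos (m + b) * expR (- (s ^+ 2 / 2)).
Proof.
pose H k := charF (m + b) k * expR (s ^+ 2 / 2 * k ^+ 2).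
have dH (k : R) : is_derive k (1 : R) H 0.
  have dX := is_deriveZ (s ^+ 2 / 2) (is_deriveX 2 (is_derive_id k (1 : R))).
  have dE := is_derive1_comp (is_derive_expR _) dX.
  have dM := is_deriveM (is_derive_charF (m + b) k) dE.
  apply: is_derive_eq; rewrite /GRing.scale /=.
  by field.
have := is_derive_0_is_cst 1 0 dH.
rewrite /H expr0n/= mulr0 expR0 mulr1 expr1n mulr1.
have -> : charF (m + b) 0 = cos (m + b).
  rewrite /charF; under eq_Rintegral do rewrite mul0r add0r.
  rewrite RintegralZl ?Rintegral_normal_pdf ?mulr1//; exact: integrable_normal_pdf.
move=> <-; rewrite expRN mulfK ?gt_eqF ?expR_gt0//.
by apply: eq_Rintegral => x _; rewrite mul1r addrA subrK.
Qed.

End NormalCharacteristic.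

(** * Gaussian random variables and uncorrelated Gaussian families *)

Section NormalProbability.
Context {R : realType}.
Context (m s : R).
Local Notation leb := (@lebesgue_measure R).
Local Notation p := (normal_pdf m s).
Local Notation nu := (@normal_prob R m s).

(** The density agrees almost everywhere with the Radon-Nikodym derivative of
    [nu], for which the change of variables is known. *)
Lemma ge0_integral_normal_prob (f : R -> R) : measurable_fun setT f ->
  (forall x, 0 <= f x) ->
  (\int[nu]_x (f x)%:E = \int[leb]_x (f x * p x)%:E)%E.
Proof.
move=> mf f0; have nudom := normal_prob_dominates m s.
rewrite -(@Radon_Nikodym_SigmaFinite.change_of_variables _ _ _ nu leb nudom (EFin \o f))//.
  apply: ae_eq_integral => //.
  - apply: emeasurable_funM; first exact/measurable_EFinP.
    exact: (measurable_int _ (Radon_Nikodym_SigmaFinite.f_integrable nudom)).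
  - by apply/measurable_EFinP; apply: measurable_funM => //; exact: measurable_normal_pdf.
  - rewrite (_ : (fun x => (f x * p x)%:E) = ((EFin \o f) \* (EFin \o p))%E)//.
    apply: ae_eqe_mul2l; apply: integral_ae_eq => //.
    + exact: Radon_Nikodym_SigmaFinite.f_integrable.
    + by apply/measurable_EFinP; exact: measurable_normal_pdf.
    + by move=> E _ mE; rewrite -Radon_Nikodym_SigmaFinite.f_integral.
by apply/measurable_EFinP.
Qed.

Lemma Rintegral_normal_prob (g : R -> R) : measurable_fun setT g ->
  leb.-integrable setT (EFin \o (fun x => g x * p x)) ->
  nu.-integrable setT (EFin \o g) /\ \int[nu]_x g x = \int[leb]_x (g x * p x).
Proof.
move=> mg ig.
have mng : measurable_fun setT (fun x => `|g x|) by exact: measurableT_comp.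
have ing : leb.-integrable setT (EFin \o (fun x => `|g x| * p x)).
  rewrite (_ : (fun x => _) = fun x => `|g x * p x|).
    exact: (integrable_norm ig).
  by apply/funext => x; rewrite normrM [`|p x|]ger0_norm ?normal_pdf_ge0.
have nug : nu.-integrable setT (EFin \o g).
  apply/integrableP; split; first exact/measurable_EFinP.
  rewrite /=.
  rewrite ge0_integral_normal_prob//.
  have /integrableP[_] := ing; apply: le_lt_trans.
  apply: ge0_le_integral => //.
  - by move=> x _; rewrite lee_fin mulr_ge0// normal_pdf_ge0.
  - by apply/measurable_EFinP; apply: measurable_funM => //; exact: measurable_normal_pdf.
  - apply: measurableT_comp => //.
    by apply/measurable_EFinP; apply: measurable_funM => //; exact: measurable_normal_pdf.
  - by move=> x _; exact: lee_abs.
split => //.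
have nung : nu.-integrable setT (EFin \o (fun x => `|g x|)) by exact: (integrable_norm nug).
have pos (h : R -> R) : measurable_fun setT h -> (forall x, 0 <= h x) ->
    \int[nu]_x h x = \int[leb]_x (h x * p x).
  by move=> mh h0; rewrite /Rintegral ge0_integral_normal_prob.
transitivity (\int[nu]_x (`|g x| + g x) - \int[nu]_x `|g x|).
  by rewrite RintegralD// addrC addrA addNr add0r.
rewrite !pos//.
- under eq_Rintegral do rewrite mulrDl.
  by rewrite RintegralD// addrC addrA addNr add0r.
- exact: measurable_funD.
- by move=> x; rewrite -lerBlDr sub0r -normrN ler_norm.
Qed.

End NormalProbability.

Section GaussianVariable.
Context {d : measure_display} {Omega : measurableType d} {R : realType}.
Context (P : probability Omega R).

Lemma Rintegral_law (nu : {measure set (measurableTypeR R) -> \bar R}) (Y : Omega -> R) (g : R -> R) :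
  measurable_fun setT Y ->
  (forall B : set R, measurable B -> P (Y @^-1` B) = nu B) ->
  measurable_fun setT g -> nu.-integrable setT (EFin \o g) ->
  P.-integrable setT (EFin \o (g \o Y)) /\ \int[P]_w g (Y w) = \int[nu]_x g x.
Proof.
move=> mY lawY mg ig.
pose Y' : Omega -> measurableTypeR R := Y.
have eqnu (f : measurableTypeR R -> \bar R) : (\int[pushforward P Y']_x f x = \int[nu]_x f x)%E.
  apply: eq_measure_integral => B mB _; exact: lawY.
have iY : P.-integrable setT (EFin \o (g \o Y)).
  apply/integrableP; split.
    by apply/measurable_EFinP; exact: measurableT_comp.
  have /integrableP[_] := ig; rewrite -eqnu ge0_integral_pushforward//.
  by apply: measurableT_comp => //; exact/measurable_EFinP.
split => //.
by rewrite /Rintegral -eqnu integral_pushforward//; exact/measurable_EFinP.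
Qed.

Lemma Lfun2P (Y : Omega -> R) : measurable_fun setT Y ->
  P.-integrable setT (EFin \o (fun w => Y w ^+ 2)) -> Y \in Lfun P 2%:E.
Proof.
move=> mY iY; rewrite inE; apply/andP; split; rewrite inE//=.
rewrite /finite_norm unlock poweR_lty//.
under eq_integral => x _.
  rewrite /= powR_mulrn// -normrX ger0_norm ?sqr_ge0//.
  over.
exact: (integrable_lty measurableT iY).
Qed.

Lemma moments_of_centered (Y : Omega -> R) (m v : R) : measurable_fun setT Y ->
  P.-integrable setT (EFin \o (fun w => (Y w - m) ^+ 2)) ->
  \int[P]_w (Y w - m) = 0 -> \int[P]_w (Y w - m) ^+ 2 = v ->
  [/\ Y \in Lfun P 2%:E, ('E_P[Y] = m%:E)%E & ('V_P[Y] = v%:E)%E].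
Proof.
move=> mY i2 E0 V0.
have Z2 : (fun w => Y w - m) \in Lfun P 2%:E.
  by apply: Lfun2P => //; exact: measurable_funB.
have Y2 : Y \in Lfun P 2%:E.
  rewrite (_ : Y = (fun w => Y w - m) \+ cst m); last first.
    by apply/funext => w /=; rewrite subrK.
  by rewrite rpredD ?lee1n//= => _; rewrite Lfun_cst.
have iY : P.-integrable setT (EFin \o Y).
  by apply/Lfun1_integrable; apply: Lfun_subset12 => //; exact: fin_num_measure.
have EY : ('E_P[Y] = m%:E)%E.
  rewrite unlock -(fineK (integrable_fin_num measurableT iY)); congr _%:E.
  rewrite -[LHS]/(\int[P]_w Y w); move: E0.
  rewrite RintegralB//; last exact: finite_measure_integrable_cst.
  have PT : fine (P setT) = 1 by rewrite probability_setT.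
  rewrite Rintegral_cst// -[fine _]/(fine (P setT)) PT mulr1 => /eqP.
  by rewrite subr_eq0 => /eqP.
split => //.
rewrite /variance unlock EY /= unlock.
rewrite -(fineK (integrable_fin_num measurableT i2)); congr _%:E.
by rewrite -V0; apply: eq_Rintegral.
Qed.

Lemma gaussian_rv_moments (Y : Omega -> R) : measurable_fun setT Y ->
  gaussian_rv P Y -> exists m v : R,
  [/\ Y \in Lfun P 2%:E, ('E_P[Y] = m%:E)%E, ('V_P[Y] = v%:E)%E
    & forall b, \int[P]_w cos (Y w + b) = cos (m + b) * expR (- (v / 2))].
Proof.
have mB (m : R) : measurable_fun setT (fun x : R => x - m) by exact: measurable_funB.
have mc (b : R) : measurable_fun setT (fun x : R => cos (x + b)).
  by apply: measurable_cos_comp; exact: measurable_funD.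
have mB2 (m : R) : measurable_fun setT (fun x : R => (x - m) ^+ 2).
  exact: measurable_funX.
move=> mY [[m [s [s0 lawY]]]|[m lawY]].
- exists m, (s ^+ 2).
  have i2 := integrable_sqr_normal_pdf m s0.
  have i1 : lebesgue_measure.-integrable setT (EFin \o (fun x => (x - m) * normal_pdf m s x)).
    apply: (integrable_bounded_normal_pdf (C := 1) s0); first exact: measurable_funB.
    by move=> x; rewrite mul1r normr_le_add1_sqr.
  have ic b : lebesgue_measure.-integrable setT
      (EFin \o (fun x => cos (x + b) * normal_pdf m s x)).
    apply: (integrable_bounded_normal_pdf (C := 1) s0) => //.
    by move=> x; rewrite mul1r (le_trans (cos_max _))// lerDl sqr_ge0.
  have [j2 e2] := Rintegral_normal_prob (mB2 m) i2.
  have [j1 e1] := Rintegral_normal_prob (mB m) i1.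
  have [k2 f2] := Rintegral_law (nu := normal_prob m s) mY lawY (mB2 m) j2.
  have [k1 f1] := Rintegral_law (nu := normal_prob m s) mY lawY (mB m) j1.
  have [] := @moments_of_centered Y m (s ^+ 2) mY k2.
  + by move: f1; rewrite e1 normal_pdf_centered.
  + by move: f2; rewrite e2 normal_pdf_second_moment.
  move=> ? ? ?; split => // b.
  have [jc ec] := Rintegral_normal_prob (mc b) (ic b).
  have [_ ->] := Rintegral_law (nu := normal_prob m s) mY lawY (mc b) jc.
  by rewrite ec normal_pdf_cos.
- exists m, 0.
  have dirac (g : R -> R) : measurable_fun setT g -> \int[P]_w g (Y w) = g m
      /\ P.-integrable setT (EFin \o (g \o Y)).
    move=> mg.
    have idg : (\d_(m : measurableTypeR R) : {measure set _ -> \bar R}).-integrable setT (EFin \o g).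
      apply/integrableP; split; first exact/measurable_EFinP.
      rewrite integral_dirac//; last by apply: measurableT_comp => //; exact/measurable_EFinP.
      by rewrite diracT mul1e ltry.
    have [? ->] := Rintegral_law (nu := \d_(m : measurableTypeR R)) mY lawY mg idg.
    split => //; rewrite /Rintegral integral_dirac//; last exact/measurable_EFinP.
    by rewrite diracT mul1e.
  have [e2 i2] := dirac _ (mB2 m).
  have [e1 _] := dirac _ (mB m).
  have [] := @moments_of_centered Y m 0 mY i2.
  + by move: e1; rewrite subrr.
  + by move: e2; rewrite subrr expr0n.
  move=> ? ? ?; split => // b.
  by rewrite mul0r oppr0 expR0 mulr1; exact: (dirac _ (mc b)).1.
Qed.

(** Affine combinations of a Gaussian process are Gaussian up to a constant;
    allowing the shift in the definition avoids translating normal laws. *)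
Definition shifted_gaussian (Y : Omega -> R) : Prop :=
  exists c : R, gaussian_rv P (fun w => Y w - c).

Lemma shifted_gaussian_moments (Y : Omega -> R) : measurable_fun setT Y ->
  shifted_gaussian Y -> exists m v : R,
  [/\ Y \in Lfun P 2%:E, ('E_P[Y] = m%:E)%E, ('V_P[Y] = v%:E)%E
    & \int[P]_w cos (Y w) = cos m * expR (- (v / 2))].
Proof.
move=> mY [c gY]; have mYc : measurable_fun setT (fun w => Y w - c).
  exact: measurable_funB.
have [m [v [Y2 EY VY cY]]] := gaussian_rv_moments mYc gY.
have Y1 : (fun w => Y w - c) \in Lfun P 1.
  by apply: Lfun_subset12 => //; exact: fin_num_measure.
have YE : Y = (fun w => Y w - c) \+ cst c.
  by apply/funext => w /=; rewrite subrK.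
exists (m + c), v; split.
- by rewrite YE rpredD ?lee1n//= => _; rewrite Lfun_cst.
- by rewrite YE expectationD ?Lfun_cst//= EY expectation_cst.
- by rewrite YE varianceD_cst_r.
- by rewrite -cY; apply: eq_Rintegral => w _; rewrite subrK.
Qed.

End GaussianVariable.

Section UncorrelatedGaussian.
Context {d : measure_display} {Omega : measurableType d} {R : realType}.
Context (P : probability Omega R).

Lemma integrable_bounded (f : Omega -> R) (C : R) : measurable_fun setT f ->
  (forall w, `|f w| <= C) -> P.-integrable setT (EFin \o f).
Proof.
move=> mf fC.
have := integrable_bounded_mul mf fC (finite_measure_integrable_cst P 1 measurableT).
by apply: eq_integrable => // w _ /=; rewrite mulr1.
Qed.

Lemma integrable_cos (Y : Omega -> R) : measurable_fun setT Y ->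
  P.-integrable setT (EFin \o (fun w => cos (Y w))).
Proof.
by move=> mY; exact: (integrable_bounded (measurable_cos_comp mY) (fun w => cos_max _)).
Qed.

(** The product of the cosines is half the sum of the cosines of [Y + Z] and
    [Y - Z]. Both have variance [V Y + V Z], so the exponential factor splits, and
    the means recombine by the same addition formula. *)
Lemma uncorrelated_gaussian_cos (Y Z : Omega -> R) :
  measurable_fun setT Y -> measurable_fun setT Z ->
  shifted_gaussian P Y -> shifted_gaussian P Z ->
  shifted_gaussian P (fun w => Y w + Z w) -> shifted_gaussian P (fun w => Y w - Z w) ->
  covariance P Y Z = 0%E ->
  \int[P]_w (cos (Y w) * cos (Z w)) = (\int[P]_w cos (Y w)) * (\int[P]_w cos (Z w)).
Proof.
move=> mY mZ gY gZ gD gB cov0.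
have mD : measurable_fun setT (fun w => Y w + Z w) by exact: measurable_funD.
have mB : measurable_fun setT (fun w => Y w - Z w) by exact: measurable_funB.
have [mu [v [Y2 EY VY ->]]] := shifted_gaussian_moments mY gY.
have [nu [u [Z2 EZ VZ ->]]] := shifted_gaussian_moments mZ gZ.
have [muD [vD [_ ED VD cD]]] := shifted_gaussian_moments mD gD.
have [muB [vB [_ EB VB cB]]] := shifted_gaussian_moments mB gB.
have Y1 : Y \in Lfun P 1 by apply: Lfun_subset12 => //; exact: fin_num_measure.
have Z1 : Z \in Lfun P 1 by apply: Lfun_subset12 => //; exact: fin_num_measure.
have muDE : muD = (mu + nu).
  apply/EFin_inj.
  by rewrite -ED EFinD -EY -EZ -expectationD.
have muBE : muB = (mu - nu).
  apply/EFin_inj.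
  by rewrite -EB EFinB -EY -EZ -expectationB.
have vDE : vD = (v + u).
  apply/EFin_inj.
  rewrite -VD EFinD -VY -VZ -[X in variance _ X]/(Y \+ Z) varianceD// cov0.
  by rewrite mule0 adde0.
have vBE : vB = (v + u).
  apply/EFin_inj.
  rewrite -VB EFinD -VY -VZ -[X in variance _ X]/(Y \- Z) varianceB// cov0.
  by rewrite mule0 sube0.
transitivity (\int[P]_w (2^-1 * cos (Y w + Z w) + 2^-1 * cos (Y w - Z w))).
  by apply: eq_Rintegral => w _; rewrite cosD cosB; field.
have iD := integrable_cos mD; have iB := integrable_cos mB.
rewrite RintegralD//; [|exact: (integrableZl _ _ iD)|exact: (integrableZl _ _ iB)].
rewrite !RintegralZl// cD cB muDE muBE vDE vBE cosD cosB.
rewrite (_ : - ((v + u) / 2) = - (v / 2) + - (u / 2)); last by field.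
by rewrite expRD; field.
Qed.

End UncorrelatedGaussian.

Section GaussianSpan.
Context {d : measure_display} {Omega : measurableType d} {R : realType}.
Context (P : probability Omega R).

Lemma gaussian_process_span (U : set R) (D : R -> Omega -> R) Y :
  gaussian_process P U D -> affine_span (D @` U) Y -> shifted_gaussian P Y.
Proof.
move=> gD SY.
suff [c [l lU ->]] : exists c, exists2 l : seq (R * R), {in l, forall p, U p.2} &
    Y = fun w => \sum_(p <- l) p.1 * D p.2 w + c.
  exists c; pose t := tnth (in_tuple l).
  have -> : (fun w => \sum_(p <- l) p.1 * D p.2 w + c - c) =
      fun w => \sum_(i < size l) (t i).1 * D (t i).2 w.
    by apply/funext => w; rewrite addrK big_tnth.
  by apply: (gD _ (fun i => (t i).2) (fun i => (t i).1)) => i; apply: lU; exact: mem_tnth.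
elim: SY => {Y} [_ [t Ut <-]|c|_ _ _ [c [l lU ->]] _ [e [k kU ->]]|a _ _ [c [l lU ->]]].
- exists 0, [:: (1, t)]; first by move=> p; rewrite inE => /eqP ->.
  by apply/funext => w; rewrite big_seq1 mul1r addr0.
- exists c, [::] => //.
  by apply/funext => w; rewrite big_nil add0r.
- exists (c + e), (l ++ k).
    by move=> p; rewrite mem_cat => /orP[/lU|/kU].
  by apply/funext => w; rewrite big_cat /= addrACA.
- exists (a * c), [seq (a * p.1, p.2) | p <- l].
    by move=> _ /mapP[p /lU Up ->].
  apply/funext => w; rewrite big_map mulrDr big_distrr /=; congr (_ + _).
  by apply: eq_bigr => p _; rewrite mulrA.
Qed.

Lemma affine_span_Lfun2 (S : set (Omega -> R)) Y :
  (forall Z, S Z -> Z \in Lfun P 2%:E) -> affine_span S Y -> Y \in Lfun P 2%:E.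
Proof.
move=> S2; elim=> {Y} [Y /S2//|c|Y Z _ Y2 _ Z2|a Y _ Y2].
- exact: Lfun_cst.
- by rewrite -[X in X \in _]/(Y \+ Z) rpredD ?lee1n//=.
- rewrite (_ : (fun w => _) = a \o* Y); last by apply/funext => w /=; rewrite mulrC.
  by rewrite Lfun_scale// ler1n.
Qed.

Lemma covariance_span_l (S : set (Omega -> R)) Y Z :
  (forall V, S V -> V \in Lfun P 2%:E) -> Z \in Lfun P 2%:E ->
  (forall V, S V -> covariance P V Z = 0%E) ->
  affine_span S Y -> covariance P Y Z = 0%E.
Proof.
have sub12 (V : Omega -> R) : V \in Lfun P 2%:E -> V \in Lfun P 1.
  by move=> V2; apply: Lfun_subset12 => //; exact: fin_num_measure.
move=> S2 Z2 SZ; elim=> {Y} [Y /SZ//|c|Y V SY cY SV cV|a Y SY cY].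
- exact: covariance_cst_l.
- rewrite -[X in covariance _ X]/(Y \+ V) covarianceDl ?cY ?cV ?adde0//.
    exact: affine_span_Lfun2 SY.
  exact: affine_span_Lfun2 SV.
- have Y2 := affine_span_Lfun2 S2 SY.
  rewrite (_ : (fun w => _) = a \o* Y); last by apply/funext => w /=; rewrite mulrC.
  have YZ1 : Y * Z \in Lfun P 1 by exact: Lfun2_mul_Lfun1.
  by rewrite (covarianceZl _ (sub12 _ Y2) (sub12 _ Z2) YZ1) cY mule0.
Qed.

Lemma uncorrelated_span_cos (U : set R) (D : R -> Omega -> R)
    (S1 S2 : set (Omega -> R)) Y Z :
  process U D -> gaussian_process P U D ->
  S1 `<=` affine_span (D @` U) -> S2 `<=` affine_span (D @` U) ->
  (forall V W, S1 V -> S2 W -> covariance P V W = 0%E) ->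
  affine_span S1 Y -> affine_span S2 Z ->
  \int[P]_w (cos (Y w) * cos (Z w)) = (\int[P]_w cos (Y w)) * (\int[P]_w cos (Z w)).
Proof.
move=> mD gD S1D S2D cov SY SZ.
have mV V : affine_span (D @` U) V -> measurable_fun setT V.
  by apply: affine_span_measurable => _ [t Ut <-]; exact: mD.
have gV V : affine_span (D @` U) V -> shifted_gaussian P V.
  exact: gaussian_process_span.
have LV V : affine_span (D @` U) V -> V \in Lfun P 2%:E.
  by move=> DV; have [? [? []]] := shifted_gaussian_moments (mV _ DV) (gV _ DV).
have DY := affine_span_subset S1D SY; have DZ := affine_span_subset S2D SZ.
apply: uncorrelated_gaussian_cos; [exact: mV|exact: mV|exact: gV|exact: gV| | |].
- exact/gV/affine_span_add.
- exact/gV/affine_span_sub.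
- apply: (covariance_span_l _ _ _ SY) => [V /S1D /LV//||V SV]; first exact: LV.
  rewrite covarianceC; apply: (covariance_span_l _ _ _ SZ) => [W /S2D /LV//||W SW].
    exact/LV/S1D.
  by rewrite covarianceC; exact: cov.
Qed.

End GaussianSpan.

(** * Independence *)

Section SigmaMeasurable.
Context {d : measure_display} {Omega : measurableType d} {R : realType}.

Definition sigma_measurable (G : set (set Omega)) (f : Omega -> R) : Prop :=
  forall B : set R, measurable B -> G (f @^-1` B).

Lemma sigma_measurableP (C : set (set Omega)) (f : Omega -> R) :
  sigma_measurable <<s C>> f <->
  measurable_fun (setT : set (g_sigma_algebraType C)) (f : g_sigma_algebraType C -> R).
Proof.
split=> [Cf _ B mB|mf B mB]; first by rewrite setTI; exact: Cf.
by have := mf measurableT B mB; rewrite setTI.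
Qed.

Lemma sigma_of_span {J : Type} (U : set J) (Z : J -> Omega -> R) Y :
  affine_span (Z @` U) Y -> sigma_measurable (sigma_of U Z) Y.
Proof.
move=> SY; apply/sigma_measurableP.
set C := (X in g_sigma_algebraType X).
apply: (@affine_span_measurable _ (g_sigma_algebraType C) _ (Z @` U)) => //.
move=> _ [u Uu <-] _ B mB.
by apply: sub_sigma_algebra; exists u => //; exists B.
Qed.

Lemma sigma_measurable_sub (G H : set (set Omega)) f :
  G `<=` H -> sigma_measurable G f -> sigma_measurable H f.
Proof. by move=> GH Gf B mB; exact: GH (Gf B mB). Qed.

Lemma sigma_measurable_fun (G : set (set Omega)) (f : Omega -> R) :
  G `<=` measurable -> sigma_measurable G f -> measurable_fun setT f.
Proof. by move=> mG Gf _ B mB; rewrite setTI; exact: mG (Gf B mB). Qed.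

Lemma sigma_measurable_cos (C : set (set Omega)) (f : Omega -> R) :
  sigma_measurable <<s C>> f -> sigma_measurable <<s C>> (fun w => cos (f w)).
Proof. by move=> /sigma_measurableP mf; apply/sigma_measurableP; exact: measurable_cos_comp. Qed.

Lemma sigma_of_subset {J J' : Type} (U : set J) (Z : J -> Omega -> R)
    (U' : set J') (Z' : J' -> Omega -> R) :
  (forall u, U u -> affine_span (Z' @` U') (Z u)) -> sigma_of U Z `<=` sigma_of U' Z'.
Proof.
move=> UZ; apply: smallest_sub; first exact: smallest_sigma_algebra.
move=> _ [u Uu [B mB <-]]; rewrite setTI.
exact: (sigma_of_span (UZ u Uu)).
Qed.

End SigmaMeasurable.

Section Independence.
Context {d : measure_display} {Omega : measurableType d} {R : realType}.
Context (P : probability Omega R).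

Lemma integrable_subr_cst (f : Omega -> R) (c : R) : P.-integrable setT (EFin \o f) ->
  P.-integrable setT (EFin \o (fun w => f w - c)).
Proof.
move=> fi.
exact: (integrableB measurableT fi (finite_measure_integrable_cst P c measurableT)).
Qed.

(** Independence of events is orthogonality of [\1_B - P B] to [G] for each
    [B] in [H]; applying [Rintegral_mul_null] first to [f] and then to [k]
    replaces the two indicators by [f] and [k]. *)
Lemma independent_Rintegral (G H : set (set Omega)) (f k : Omega -> R) (C D : R) :
  G `<=` measurable -> H `<=` measurable -> independent_algebras P G H ->
  sigma_measurable G f -> sigma_measurable H k ->
  (forall w, `|f w| <= C) -> (forall w, `|k w| <= D) ->
  \int[P]_w (f w * k w) = (\int[P]_w f w) * (\int[P]_w k w).
Proof.
move=> mG mH indep Gf Hk fC kD.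
have mf := sigma_measurable_fun mG Gf; have mk := sigma_measurable_fun mH Hk.
have fi := integrable_bounded P mf fC; have ki := integrable_bounded P mk kD.
pose c := \int[P]_w f w.
have fin_P A : measurable A -> P A \is a fin_num by exact: fin_num_measure.
have f_indic B : H B -> \int[P]_(w in B) (f w - c) = 0.
  move=> HB; have mB := mH _ HB; pose b := fine (P B).
  have ind_meas : measurable_fun setT (\1_B : Omega -> R) by [].
  have ind_le w : `|\1_B w| <= 1 :> R by rewrite indicE; case: (_ \in _); rewrite ?normr1 ?normr0.
  have ind_i := integrable_bounded P ind_meas ind_le.
  have psi_i := integrable_subr_cst b ind_i.
  have psi0 A : G A -> \int[P]_(w in A) (\1_B w - b) = 0.
    move=> GA; have mA := mG _ GA.
    rewrite RintegralB//; [|exact: integrableS ind_i|exact: finite_measure_integrable_cst].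
    rewrite Rintegral_cst// /Rintegral integral_indic// setIC.
    transitivity (fine (P (A `&` B)) - b * fine (P A)) => //.
    rewrite indep// fineM ?fin_P//.
    by rewrite /b mulrC subrr.
  have fpsi_i : P.-integrable setT (EFin \o (fun w => f w * (\1_B w - b))).
    exact: integrable_bounded_mul fC psi_i.
  have := Rintegral_mul_null mG psi0 psi_i Gf fpsi_i.
  have i1 : P.-integrable setT (EFin \o (fun w => f w * \1_B w)).
    exact: integrable_bounded_mul fC ind_i.
  under eq_Rintegral do rewrite mulrBr.
  rewrite RintegralB//; last exact: (integrableZr _ b fi).
  rewrite RintegralZr// -/c => /eqP; rewrite subr_eq0 => /eqP f1B.
  rewrite RintegralB//; [|exact: integrableS fi|exact: finite_measure_integrable_cst].
  rewrite Rintegral_cst// -[fine _]/b Rintegral_mkcond.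
  apply/eqP; rewrite subr_eq0 -f1B; apply/eqP.
  apply: eq_Rintegral => w _; rewrite patchE indicE.
  by case: (_ \in _); rewrite ?mulr1 ?mulr0.
have fc_i := integrable_subr_cst c fi.
have kfc_i : P.-integrable setT (EFin \o (fun w => k w * (f w - c))).
  exact: integrable_bounded_mul kD fc_i.
have := Rintegral_mul_null mH f_indic fc_i Hk kfc_i.
under eq_Rintegral do rewrite mulrBr.
have kf_i : P.-integrable setT (EFin \o (fun w => k w * f w)).
  exact: integrable_bounded_mul kD fi.
rewrite RintegralB//; last exact: (integrableZr _ c ki).
rewrite RintegralZr// => /eqP; rewrite subr_eq0 => /eqP fk.
by under eq_Rintegral do rewrite mulrC; rewrite fk mulrC.
Qed.

End Independence.

Section SpanDecomposition.
Context {T : Type} {R : realType}.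
Implicit Types (S : set (T -> R)).

Lemma affine_span_setU S1 S2 Y : affine_span (S1 `|` S2) Y ->
  exists Y1 Y2, [/\ affine_span S1 Y1, affine_span S2 Y2 & Y = fun w => Y1 w + Y2 w].
Proof.
elim=> {Y} [Y [SY|SY]|c|_ _ _ [Y1 [Y2 [S1Y S2Y ->]]] _ [Z1 [Z2 [S1Z S2Z ->]]]
           |a _ _ [Y1 [Y2 [S1Y S2Y ->]]]].
- exists Y, (fun=> 0); split; [exact: affine_span_gen|exact: affine_span_cst|].
  by apply/funext => w; rewrite addr0.
- exists (fun=> 0), Y; split; [exact: affine_span_cst|exact: affine_span_gen|].
  by apply/funext => w; rewrite add0r.
- exists (fun=> c), (fun=> 0); split; [exact: affine_span_cst|exact: affine_span_cst|].
  by apply/funext => w; rewrite addr0.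
- exists (fun w => Y1 w + Z1 w), (fun w => Y2 w + Z2 w).
  split; [exact: affine_span_add|exact: affine_span_add|].
  by apply/funext => w; rewrite addrACA.
- exists (fun w => a * Y1 w), (fun w => a * Y2 w).
  split; [exact: affine_span_scale|exact: affine_span_scale|].
  by apply/funext => w; rewrite mulrDr.
Qed.

End SpanDecomposition.

Section CosineSplit.
Context {d : measure_display} {Omega : measurableType d} {R : realType}.
Context (P : probability Omega R).

(** [cos (Y1 + Y2) = cos Y1 * cos Y2 - sin Y1 * sin Y2], and both sines are
    cosines of elements of the spans, shifted by [pi / 2]. *)
Lemma Rintegral_cos_split (S1 S2 : set (Omega -> R)) (psi : Omega -> R) :
  (forall Y, (S1 `|` S2) Y -> measurable_fun setT Y) ->
  P.-integrable setT (EFin \o psi) ->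
  (forall Y1 Y2, affine_span S1 Y1 -> affine_span S2 Y2 ->
     \int[P]_w (cos (Y1 w) * cos (Y2 w) * psi w) = 0) ->
  forall Y, affine_span (S1 `|` S2) Y -> \int[P]_w (cos (Y w) * psi w) = 0.
Proof.
move=> mS psi_i null Y /affine_span_setU[Y1 [Y2 [S1Y S2Y ->]]].
have mY1 : measurable_fun setT Y1.
  by apply: affine_span_measurable S1Y => Z SZ; apply: mS; left.
have mY2 : measurable_fun setT Y2.
  by apply: affine_span_measurable S2Y => Z SZ; apply: mS; right.
have cc_i (a b : R) : P.-integrable setT
    (EFin \o (fun w => cos (Y1 w + a) * cos (Y2 w + b) * psi w)).
  apply: (integrable_bounded_mul (C := 1)) => //.
    by apply: measurable_funM; apply: measurable_cos_comp; exact: measurable_funD.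
  by move=> w; rewrite normrM -[leRHS]mulr1; apply: ler_pM => //; exact: cos_max.
have shift (a b : R) : \int[P]_w (cos (Y1 w + a) * cos (Y2 w + b) * psi w) = 0.
  by apply: null; apply: affine_span_add => //; exact: affine_span_cst.
transitivity (\int[P]_w (cos (Y1 w + 0) * cos (Y2 w + 0) * psi w
            - cos (Y1 w + - (pi / 2)) * cos (Y2 w + - (pi / 2)) * psi w)).
  by apply: eq_Rintegral => w _; rewrite !addr0 !cosBpihalf cosD; ring.
by rewrite RintegralB// !shift subrr.
Qed.

End CosineSplit.

(** * Conditional probabilities *)

Section RestrictedMeasure.
Context {d : measure_display} {Omega : measurableType d} {R : realType}.
Context (P : probability Omega R) (C : set (set Omega)) (E : set Omega).
Hypotheses (mC : <<s C>> `<=` measurable) (mE : measurable E).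

(** Only the domain changes: the measure lives on the type whose measurable sets
    are [<<s C>>], where the Radon-Nikodym derivative is [<<s C>>]-measurable. The
    proofs among the arguments make the measure structure inferable. *)
Definition sub_measure of <<s C>> `<=` measurable & measurable E :
  set (g_sigma_algebraType C) -> \bar R := fun A => P (A `&` E).

Local Notation nu := (sub_measure mC mE).

Let nu0 : nu set0 = 0%E.
Proof. by rewrite /sub_measure set0I measure0. Qed.

Let nu_ge0 A : (0 <= nu A)%E. Proof. exact: measure_ge0. Qed.

Let nu_sigma_additive : semi_sigma_additive nu.
Proof.
move=> F mF tF mUF.
apply: (@measure_semi_sigma_additive _ _ _ (mrestr P mE) F) => //.
  by move=> n; exact: mC (mF n).
exact: mC mUF.
Qed.

HB.instance Definition _ := isMeasure.Build _ _ _ nu nu0 nu_ge0 nu_sigma_additive.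

Let nu_fin : fin_num_fun nu.
Proof.
by move=> A mA; apply: fin_num_measure; apply: measurableI => //; exact: mC mA.
Qed.

HB.instance Definition _ := Measure_isFinite.Build _ _ _ nu nu_fin.

End RestrictedMeasure.

Section CondProbExistence.
Context {d : measure_display} {Omega : measurableType d} {R : realType}.
Context (P : probability Omega R).

(** The version is the Radon-Nikodym derivative, on [<<s C>>], of
    [A |-> P (A `&` E)] with respect to the restriction of [P]. *)
Lemma cond_prob_version_exists (C : set (set Omega)) (E : set Omega) :
  <<s C>> `<=` measurable -> measurable E ->
  exists Y, cond_prob_version P <<s C>> E Y.
Proof.
move=> mC mE; pose T' := g_sigma_algebraType C.
pose mu : {finite_measure set T' -> \bar R} := sub_measure P mC (measurableT : measurable (setT : set Omega)).
pose nu : {finite_measure set T' -> \bar R} := sub_measure P mC mE.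
have muA A : mu A = P A by exact: (congr1 P (setIT (A : set Omega))).
have numu : nu `<< mu.
  apply/null_content_dominatesP => A mA; rewrite -[X in X = _ -> _]/(mu A) muA => PA0.
  have mA' : measurable (A : set Omega) by exact: mC mA.
  apply/eqP; rewrite eq_le measure_ge0 andbT -[X in (_ <= X)%E]PA0.
  by apply: le_measure; rewrite ?inE//; exact: measurableI.
pose f : T' -> \bar R := Radon_Nikodym (charge_of_finite_measure nu) mu.
have fint : mu.-integrable setT f by exact: Radon_Nikodym_integrable.
have ffin w : f w \is a fin_num by exact: Radon_Nikodym_fin_num.
have mf : measurable_fun (setT : set T') f by exact: (measurable_int _ fint).
have fE A : <<s C>> A -> P (A `&` E) = (\int[mu]_(x in A) f x)%E.
  by move=> CA; exact: (@Radon_Nikodym_integral _ _ _ (charge_of_finite_measure nu) mu A numu CA).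
pose phi : Omega -> T' := id.
have mphi : measurable_fun setT phi.
  by move=> _ A mA; rewrite setTI; exact: mC mA.
have muE (g : T' -> \bar R) D : measurable D ->
    (\int[mu]_(x in D) g x = \int[pushforward P phi]_(x in D) g x)%E.
  move=> mD; apply: eq_measure_integral => B mB _.
  exact: (muA B).
have fP : P.-integrable setT f.
  apply/integrableP; split; first exact: (measurableT_comp mf mphi).
  have /integrableP[_] := fint.
  rewrite muE// ge0_integral_pushforward//.
  exact: measurableT_comp.
exists (fun w => fine (f w)); split.
- have mY : measurable_fun (setT : set T') (fun w => fine (f w)) by exact: measurableT_comp.
  by move=> B mB; have := mY measurableT B mB; rewrite setTI.
- apply: eq_integrable fP => // w _.
  by rewrite /= fineK.
- move=> A CA; have mA := mC _ CA; rewrite setIC fE// muE//.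
  rewrite integral_pushforward//; last exact: (integrableS _ _ _ fP).
  by apply: eq_integral => w _; rewrite /= fineK.
Qed.

End CondProbExistence.

Section ConditionalIndependence.
Context {d : measure_display} {Omega : measurableType d} {R : realType}.
Context (P : probability Omega R).

(** Information independent of a sigma-algebra containing both [E] and the
    conditioning does not change a conditional probability. The sigma-algebra
    [<<s C>>] plays that role, and [N] is the independent information. By
    [cosine_test] it suffices to test [Y - \1_E] against [cos (a + q)] with [a]
    in the span of the conditioning variables and [q] in the span of [N]: the
    factor [cos q] can be replaced by its mean, and [cos a] is then integrated
    against [Y - \1_E], which vanishes by the definition of [Y]. *)
Lemma cond_prob_version_enlarge {J J' : Type} (F : set J) (ZF : J -> Omega -> R)
    (H : set J') (ZH : J' -> Omega -> R) (N : set (Omega -> R))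
    (C : set (set Omega)) (E : set Omega) (Y : Omega -> R) :
  (forall u, F u -> measurable_fun setT (ZF u)) ->
  (forall V, N V -> measurable_fun setT V) ->
  <<s C>> `<=` measurable ->
  sigma_of H ZH `<=` sigma_of F ZF -> sigma_of H ZH `<=` <<s C>> -> <<s C>> E ->
  (forall u, F u -> affine_span (ZH @` H `|` N) (ZF u)) ->
  (forall V A, affine_span N V -> <<s C>> A ->
     \int[P]_(w in A) (cos (V w) - \int[P]_x cos (V x)) = 0) ->
  cond_prob_version P (sigma_of H ZH) E Y -> cond_prob_version P (sigma_of F ZF) E Y.
Proof.
move=> mF mN mC HF HC CE FHN orthN [HY Y_i YE].
have mE : measurable E := mC _ CE.
have mH := subset_trans HC mC.
have fin_P A : measurable A -> P A \is a fin_num by exact: fin_num_measure.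
pose psi w := Y w - \1_E w.
have ind_i : P.-integrable setT (EFin \o (\1_E : Omega -> R)).
  by apply: (@integrable_bounded _ _ _ _ _ 1) => // w; rewrite indicE; case: (_ \in _);
    rewrite ?normr1 ?normr0.
have psi_i : P.-integrable setT (EFin \o psi) by exact: (integrableB measurableT Y_i ind_i).
have psiE A : measurable A ->
    \int[P]_(w in A) psi w = \int[P]_(w in A) Y w - fine (P (E `&` A)).
  move=> mA; rewrite RintegralB//; [|exact: integrableS Y_i|exact: integrableS ind_i].
  by congr (_ - _); rewrite /Rintegral integral_indic.
have psi0H A : sigma_of H ZH A -> \int[P]_(w in A) psi w = 0.
  move=> HA; rewrite psiE; last exact: mH.
  by rewrite /Rintegral YE// subrr.
have psi0F A : sigma_of F ZF A -> \int[P]_(w in A) psi w = 0.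
  apply: cosine_test => // W.
  move=> /(affine_span_subset (S' := ZH @` H `|` N)) SW.
  have {}SW : affine_span (ZH @` H `|` N) W.
    by apply: SW => _ [u Fu <-]; exact: FHN.
  apply: (Rintegral_cos_split _ psi_i _ SW).
    move=> V [[u Hu <-]|/mN//]; apply: (sigma_measurable_fun mH).
    by apply: sigma_of_span; apply: affine_span_gen; exists u.
  move=> a q Ha Nq.
  have mq : measurable_fun setT q by exact: affine_span_measurable Nq.
  have mcosq := measurable_cos_comp mq.
  have Hcosa := sigma_measurable_cos (sigma_of_span Ha).
  have mcosa := sigma_measurable_fun mH Hcosa.
  have apsi_i : P.-integrable setT (EFin \o (fun w => cos (a w) * psi w)).
    by apply: (integrable_bounded_mul mcosa _ psi_i) => w; exact: cos_max.
  (* [Y - \1_E] is orthogonal to the conditioning sigma-algebra *)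
  have apsi0 : \int[P]_w (cos (a w) * psi w) = 0.
    exact: (Rintegral_mul_null mH psi0H psi_i Hcosa apsi_i).
  pose c := \int[P]_w cos (q w).
  have q_i : P.-integrable setT (EFin \o (fun w => cos (q w) - c)).
    exact: (integrable_subr_cst c (integrable_cos P mq)).
  have qapsi_i : P.-integrable setT (EFin \o (fun w => cos (q w) * (cos (a w) * psi w))).
    by apply: (integrable_bounded_mul mcosq _ apsi_i) => w; exact: cos_max.
  have prodE : (fun w => cos (a w) * psi w * (cos (q w) - c)) =
      fun w => cos (q w) * (cos (a w) * psi w) - c * (cos (a w) * psi w).
    by apply/funext => w; ring.
  have prod_i : P.-integrable setT (EFin \o (fun w => cos (a w) * psi w * (cos (q w) - c))).
    rewrite prodE.
    exact: (integrableB measurableT qapsi_i (integrableZl measurableT c apsi_i)).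
  (* so [cos q] minus its mean, orthogonal to [<<s C>>], is orthogonal to it *)
  have Capsi : sigma_measurable <<s C>> (fun w => cos (a w) * psi w).
    apply/sigma_measurableP; apply: measurable_funM.
      by apply/sigma_measurableP; exact: (sigma_measurable_sub HC Hcosa).
    apply: measurable_funB.
      by apply/sigma_measurableP; exact: (sigma_measurable_sub HC HY).
    have mE' : measurable (E : set (g_sigma_algebraType C)) by [].
    exact: (measurable_indic (D := setT) mE').
  have := Rintegral_mul_null mC (fun A => orthN q A Nq) q_i Capsi prod_i.
  rewrite prodE RintegralB//; last exact: (integrableZl _ c apsi_i).
  rewrite RintegralZl// apsi0 mulr0 subr0 => <-.
  by apply: eq_Rintegral => w _; ring.
split => //.
- by move=> B mB; apply: HF; exact: HY.
- move=> A FA; have mA := sigma_of_measurable mF FA.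
  have /eqP := psi0F A FA; rewrite psiE// subr_eq0 => /eqP.
  rewrite /Rintegral => YA.
  rewrite -[RHS]fineK ?fin_P//; last exact: measurableI.
  rewrite -YA fineK//; apply: integrable_fin_num => //.
  exact: integrableS Y_i.
Qed.

End ConditionalIndependence.

(** * Randomised arcade processes *)

Section Dates.
Context {R : realType} (n : nat) (T : nat -> R).
Hypothesis datesT : dates n T.

Lemma dates_le i j : (i <= j <= n)%N -> T i <= T j.
Proof.
move=> /andP[ij jn]; elim: j ij jn => [|j IH]; first by rewrite leqn0 => /eqP ->.
rewrite leq_eqVlt => /orP[/eqP -> //|ij] jn.
apply: le_trans (IH ij (ltnW jn)) _; apply: ltW; exact: datesT.2.
Qed.

Lemma last_date_leq s : (last_date n T s <= n)%N.
Proof. by apply/bigmax_leqP => i _; rewrite -ltnS. Qed.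

Lemma last_date_le s : T 0%N <= s -> T (last_date n T s) <= s.
Proof.
move=> T0s; rewrite /last_date.
apply: (big_ind (fun k => T k <= s)) => // i j Ti Tj.
by rewrite /maxn; case: ifP.
Qed.

Lemma last_date_max s i : (i <= n)%N -> T i <= s -> (i <= last_date n T s)%N.
Proof.
move=> iN Tis; have := @leq_bigmax_cond _ (fun k : 'I_n.+1 => T k <= s) (fun k => k : nat)
  (Ordinal (iN : (i < n.+1)%N)) Tis.
by [].
Qed.

Lemma last_date_gt s i : (i <= n)%N -> (last_date n T s < i)%N -> s < T i.
Proof. by move=> iN; rewrite ltnNge ltNge; apply: contra; exact: last_date_max. Qed.

End Dates.

Section RandomisedArcade.
Context {d : measure_display} {Omega : measurableType d} {R : realType}.
Context (n : nat) (T : nat -> R).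
Hypothesis datesT : dates n T.
Implicit Types (D : R -> Omega -> R) (X : 'I_n.+1 -> Omega -> R) (f g : 'I_n.+1 -> R -> R).

Lemma date_in (i : 'I_n.+1) : T i \in `[T 0%N, T n].
Proof.
have iN : (i <= n)%N by rewrite -ltnS.
by rewrite in_itv/= !(dates_le datesT)// iN leqnn.
Qed.

Lemma arcade_span f D u : u \in `[T 0%N, T n] ->
  affine_span (D @` [set` `[T 0%N, T n]]) (arcade T f D u).
Proof.
move=> uT; apply: affine_span_sub; first by apply: affine_span_gen; exists u.
apply: affine_span_sum => i; apply: affine_span_scale; apply: affine_span_gen.
by exists (T i) => //; exact: date_in.
Qed.

Lemma signal_span g X u : affine_span (range X) (signal g X u).
Proof.
apply: affine_span_sum => i; apply: affine_span_scale.
by apply: affine_span_gen; exists i.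
Qed.

Lemma rap_date f g D X (i : 'I_n.+1) : interpolating T f -> interpolating T g ->
  rap T f g D X (T i) = X i.
Proof.
move=> [_ fT] [_ gT]; apply/funext => w; rewrite rapE /signal /arcade.
rewrite (bigD1 i)//= gT eqxx mul1r big1 ?addr0; last first.
  by move=> j ji; rewrite gT (negbTE ji) mul0r.
rewrite (bigD1 i)//= fT eqxx mul1r big1 ?addr0 ?subrr ?addr0// => j ji.
by rewrite fT (negbTE ji) mul0r.
Qed.

End RandomisedArcade.

Section NoiseRegression.
Context {R : realType} (n : nat) (T : nat -> R) (A1 A2 : R -> R) (s : R).
Hypothesis datesT : dates n T.
Hypothesis nondegenerateA : forall t : R, open_dates n T t -> A1 t != 0.
Hypotheses (T0s : T 0%N <= s) (sTn : s <= T n).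

Local Notation m := (last_date n T s).

(** The coefficient of the linear regression of [A u] on [A s], for [u <= s]:
    the noise up to [T m] is independent of [A s], while on the open interval
    containing [s] the covariance factorises. *)
Definition noise_regression u := if T m < u then A1 u / A1 s else 0.

Let s_lt i : (i <= n)%N -> (m < i)%N -> s < T i.
Proof. exact: last_date_gt. Qed.

Let m_lt_n u : T m < u -> u <= s -> (m < n)%N.
Proof.
move=> Tmu us; rewrite ltn_neqAle last_date_leq andbT; apply/eqP => mE.
by have := lt_le_trans Tmu (le_trans us sTn); rewrite mE ltxx.
Qed.

Let A1s_neq0 u : T m < u -> u <= s -> A1 s != 0.
Proof.
move=> Tmu us; have mn := m_lt_n Tmu us; apply: nondegenerateA; exists m => //.
by rewrite /= in_itv/= (lt_le_trans Tmu us) s_lt.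
Qed.

(** Up to time [s] only the signal coefficients of the dates after [T m] are
    constrained, and they obey the same proportionality as the noise: all of
    them vanish except the one of the next date, which is a multiple of [A1].
    This is where the compatibility of [g] with [A1] enters. *)
Lemma signal_regression (g : 'I_n.+1 -> R -> R) (i : 'I_n.+1) u :
  (forall j : 'I_n.+1, (1 <= j)%N ->
     forall x : R, x \in `[T 0%N, T j.-1] -> g j x = 0) ->
  (forall j : 'I_n.+1, (1 <= j)%N ->
     exists A1j : R -> R,
       (forall x : R, x \in `]T j.-1, T j[ -> A1j x = A1 x) /\
       (forall x : R, x \in `[T j.-1, T j] -> g j x * A1j (T j) = A1j x)) ->
  (m < i)%N -> T 0%N <= u <= s -> g i u = noise_regression u * g i s.
Proof.
move=> g_eq0 g_A1 mi /andP[T0u us]; have iN : (i <= n)%N by rewrite -ltnS.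
have i1 : (1 <= i)%N by exact: leq_ltn_trans mi.
have i1m : (m <= i.-1)%N by rewrite -ltnS prednK.
have i1n : (i.-1 <= n)%N by rewrite (leq_trans (leq_pred _)).
rewrite /noise_regression; case: ifPn => [Tmu|]; last first.
  rewrite -leNgt mul0r => uTm; apply: (g_eq0 i i1 u).
  by rewrite in_itv/= T0u (le_trans uTm)// (dates_le datesT)// i1m.
have [im|im] := eqVneq i.-1 m.
  have [A1j [A1jE gA1j]] := g_A1 i i1.
  have gA1E x : T m < x -> x <= s -> g i x * A1j (T i) = A1 x.
    move=> Tmx xs; have xI : T i.-1 < x < T i.
      by rewrite im Tmx (le_lt_trans xs)// s_lt.
    rewrite gA1j ?A1jE ?in_itv//=.
    by have /andP[/ltW -> /ltW ->] := xI.
  have gs := gA1E s (lt_le_trans Tmu us) (lexx s).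
  have A1s0 := A1s_neq0 Tmu us.
  have c0 : A1j (T i) != 0 by apply: contraNneq A1s0 => c0; rewrite -gs c0 mulr0.
  apply: (mulIf c0); transitivity (A1 u / A1 s * (g i s * A1j (T i))).
    by rewrite gs divfK// gA1E.
  by rewrite mulrA.
have sTi : s <= T i.-1.
  by apply/ltW/s_lt => //; rewrite ltn_neqAle eq_sym im.
rewrite (g_eq0 i i1 u) ?(g_eq0 i i1 s) ?mulr0// in_itv/= ?T0u ?T0s//.
exact: le_trans sTi.
Qed.

(** The regression coefficient does not depend on [v]: given [A s], the noise
    before [s] carries no further linear information on the noise after [s]. *)
Lemma covariance_regression u v : u <= s -> s <= v ->
  \sum_(i < n) A1 (Num.min u v) * A2 (Num.max u v) *
     \1_(`]T i, T i.+1[ `*` `]T i, T i.+1[) (u, v) =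
  noise_regression u * \sum_(i < n) A1 (Num.min s v) * A2 (Num.max s v) *
     \1_(`]T i, T i.+1[ `*` `]T i, T i.+1[) (s, v) :> R.
Proof.
move=> us sv; have uv : u <= v := le_trans us sv.
have Tms : T m <= s := last_date_le n T0s.
rewrite big_distrr/=; apply: eq_bigr => i _.
have iN : (i < n)%N by [].
rewrite !min_l// !max_r// !indicE.
have outside_lt x : (i < m)%N -> T m <= x -> (x < T i.+1) = false.
  move=> im Tmx; apply/negbTE; rewrite -leNgt (le_trans _ Tmx)//.
  by rewrite (dates_le datesT)// im last_date_leq.
rewrite /noise_regression; case: ifPn => [Tmu|]; last first.
  rewrite -leNgt mul0r => uTm.
  rewrite memNset ?mulr0// => -[/=]; rewrite !in_itv/= => /andP[Tiu _] /andP[_].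
  rewrite outside_lt// ?(le_trans Tms)//.
  rewrite ltnNge; apply/negP => mi.
  by have := lt_le_trans Tiu uTm; rewrite ltNge (dates_le datesT)// mi ltnW.
have mN := m_lt_n Tmu us.
have [im|im] := eqVneq (i : nat) m.
  have inI x : T m < x -> x <= s -> ((x, v) \in `]T i, T i.+1[ `*` `]T i, T i.+1[) =
      (v \in `]T i, T i.+1[).
    move=> Tmx xs; apply/idP/idP => [/set_mem[]//|vI]; apply/mem_set.
    by split => //=; rewrite in_itv/= im Tmx (le_lt_trans xs)// s_lt.
  rewrite !inI// ?(lt_le_trans Tmu)//.
  by rewrite !mulrA divfK//; exact: (A1s_neq0 Tmu us).
have outI x : T m < x -> x <= s -> ((x, v) \in `]T i, T i.+1[ `*` `]T i, T i.+1[) = false.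
  move=> Tmx xs; apply: memNset => -[/= xI _]; move: xI; rewrite in_itv/=.
  have [im'|mi] := ltnP i m; first by rewrite outside_lt ?andbF// ltW.
  move=> /andP[+ _]; rewrite ltNge (le_trans xs)//.
  by apply/ltW/(s_lt (ltnW iN)); rewrite ltn_neqAle eq_sym im.
by rewrite !outI// ?(lt_le_trans Tmu)// !mulr0.
Qed.

End NoiseRegression.

Theorem theorem4p2 (d : measure_display) (Omega : measurableType d)
  (R : realType) (P : probability Omega R)
  (n : nat) (T : nat -> R)
  (D : R -> Omega -> R) (X : 'I_n.+1 -> {RV P >-> R})
  (f g : 'I_n.+1 -> R -> R) (A1 A2 : R -> R)
  (n_ge1 : (1 <= n)%N)
  (datesT : dates n T)
  (processD : process `[T 0%N, T n] D)
  (continuousD : sample_continuous P `[T 0%N, T n] D)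
  (nondegenerateD : forall (c t : R), open_dates n T t ->
     (P (D t @^-1` [set c]) < 1)%E)
  (gaussianD : gaussian_process P `[T 0%N, T n] D)
  (independentXD : independent_algebras P (sigma_of setT (fun i => X i : Omega -> R))
     (sigma_of `[T 0%N, T n] D))
  (interpolatingf : interpolating T f)
  (interpolatingg : interpolating T g)
  (covarianceA : forall s t : R, s \in `[T 0%N, T n] -> t \in `[T 0%N, T n] ->
     covariance P (arcade T f D s) (arcade T f D t) =
     (\sum_(i < n) A1 (Num.min s t) * A2 (Num.max s t) *
        \1_(`]T i, T i.+1[ `*` `]T i, T i.+1[) (s, t))%:E)
  (nondegenerateA : forall t : R, open_dates n T t -> A1 t != 0)
  (g_eq0 : forall j : 'I_n.+1, (1 <= j)%N ->
     forall x : R, x \in `[T 0%N, T j.-1] -> g j x = 0)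
  (g_A1 : forall j : 'I_n.+1, (1 <= j)%N ->
     exists A1j : R -> R,
       [/\ {within `[T j.-1, T j], continuous A1j},
           forall x : R, x \in `]T j.-1, T j[ -> A1j x = A1 x
         & forall x : R, x \in `[T j.-1, T j] -> g j x * A1j (T j) = A1j x]) :
  cond_markov n T P (rap T f g D (fun i => X i : Omega -> R)).
Proof.
move=> s t B sT tT st mB.
set Xr := (fun i => X i : Omega -> R).
pose m := last_date n T s.
pose A := arcade T f D; pose I := rap T f g D Xr.
have /andP[T0s sTn] : T 0%N <= s <= T n by move: sT; rewrite in_itv.
have /andP[T0t tTn] : T 0%N <= t <= T n by move: tT; rewrite in_itv.
have mn : (m <= n)%N := last_date_leq n T s.
have Tms : T m <= s := last_date_le n T0s.
pose past u := T 0%N <= u <= s.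
pose rho := noise_regression n T A1 s.
have g_rho (i : 'I_n.+1) u : (m < i)%N -> past u -> g i u = rho u * g i s.
  apply: signal_regression => // j /g_A1[A1j [_ A1jE gA1j]].
  by exists A1j.
(* the residual of the regression of the noise at [u] on the noise at [s] *)
pose Q u (w : Omega) : R := A u w - rho u * A s w.
have I_dec u w : I u w = Q u w + rho u * I s w
    + \sum_(i < n.+1) (g i u - rho u * g i s) * X i w.
  rewrite /I !rapE /Q -/A.
  have -> : \sum_(i < n.+1) (g i u - rho u * g i s) * X i w =
      signal g Xr u w - rho u * signal g Xr s w.
    rewrite /signal big_distrr/= -sumrB; apply: eq_bigr => i _.
    by rewrite mulrBl mulrA.
  by ring.
have cov_rho u v : past u -> s <= v -> v <= T n ->
    covariance P (A u) (A v) = ((rho u)%:E * covariance P (A s) (A v))%E.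
  move=> /andP[T0u us] sv vTn.
  have T0v : T 0%N <= v := le_trans T0s sv.
  rewrite !covarianceA ?in_itv/= ?T0u ?T0v ?T0s ?(le_trans us) ?(le_trans sv)//.
  by rewrite -EFinM (covariance_regression A2 datesT nondegenerateA T0s sTn).
have nT : forall i : 'I_n.+1, I (T i) = Xr i by move=> i; exact: rap_date.
have mX i : measurable_fun setT (Xr i) by exact: measurable_funP.
have A_span u : T 0%N <= u <= T n -> affine_span (D @` [set` `[T 0%N, T n]]) (A u).
  by move=> uT; apply: arcade_span; rewrite ?in_itv.
have past_in u : past u -> T 0%N <= u <= T n.
  by move=> /andP[-> us]; exact: le_trans us sTn.
have mD V : affine_span (D @` [set` `[T 0%N, T n]]) V -> measurable_fun setT V.
  by apply: affine_span_measurable => _ [u uT <-]; exact: processD.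
have sT' : T 0%N <= s <= T n by rewrite T0s.
(* what the residuals are independent of: all of [X] and the noise from [s] on *)
pose SA : set (Omega -> R) := A @` [set` `[s, T n]].
pose SX : set (Omega -> R) := range Xr.
pose C := \bigcup_(V in SX `|` SA) preimage_set_system setT (id V) measurable.
pose N : set (Omega -> R) := Q @` [set` `[T 0%N, s]].
have SA_D : SA `<=` affine_span (D @` [set` `[T 0%N, T n]]).
  move=> _ [v + <-]; rewrite /= in_itv/= => /andP[sv vT].
  by apply: A_span; rewrite (le_trans T0s sv).
have N_D : N `<=` affine_span (D @` [set` `[T 0%N, T n]]).
  move=> _ [u + <-]; rewrite /= in_itv/= => up.
  by apply: affine_span_sub; [|apply: affine_span_scale]; apply: A_span => //; exact: past_in.
have mS V : (SX `|` SA) V -> measurable_fun setT V.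
  by case=> [[i _ <-] //|/SA_D /mD].
have mC : <<s C>> `<=` measurable.
  exact: (@sigma_of_measurable _ _ _ _ (SX `|` SA) id mS).
have I_span v : s <= v -> v <= T n -> affine_span (id @` (SX `|` SA)) (I v).
  move=> sv vT; rewrite image_id.
  rewrite (_ : I v = fun w => signal g Xr v w + A v w); last first.
    by apply/funext => w; rewrite /I rapE.
  apply: affine_span_add.
    apply: (affine_span_subset _ (signal_span g Xr v)) => V SV.
    by apply: affine_span_gen; left.
  apply: affine_span_gen; right; exists v => //.
  by rewrite /= in_itv/= sv.
pose F : set R := [set` `[T 0%N, s]].
pose H : set R := [set T i | i in [set i | (i <= m)%N]] `|` [set s].
have HF : sigma_of H I `<=` sigma_of F I.
  apply: sigma_of_subset => u Hu; apply: affine_span_gen; exists u => //.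
  case: Hu => [[i /= im <-]|->]; rewrite /F /= in_itv/= ?T0s ?lexx//.
  by rewrite (dates_le datesT) ?(leq_trans im)//= (le_trans _ Tms)// (dates_le datesT)// im.
have HC : sigma_of H I `<=` <<s C>>.
  apply: (@sigma_of_subset _ _ _ _ _ H I (SX `|` SA) id) => u [[i /= im <-]|->].
    have iN : (i < n.+1)%N by rewrite ltnS (leq_trans im).
    rewrite image_id (nT (Ordinal iN)).
    by apply: affine_span_gen; left; exists (Ordinal iN).
  exact: I_span.
have CE : <<s C>> (I t @^-1` B).
  exact: (sigma_of_span (I_span t st tTn) mB).
have FHN u : F u -> affine_span (I @` H `|` N) (I u).
  rewrite /F /= in_itv/= => up.
  rewrite (_ : I u = fun w => Q u w + rho u * I s w
      + \sum_(i < n.+1) (g i u - rho u * g i s) * X i w); last first.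
    by apply/funext => w; exact: I_dec.
  apply: affine_span_add.
    apply: affine_span_add.
      by apply: affine_span_gen; right; exists u => //; rewrite /= in_itv.
    by apply: affine_span_scale; apply: affine_span_gen; left; exists s => //; right.
  apply: affine_span_sum => i; have [im|mi] := leqP i m.
    apply: affine_span_scale; apply: affine_span_gen; left; exists (T i); last exact: nT.
    by left; exists i.
  under eq_fun do rewrite (g_rho i u mi up) subrr mul0r.
  exact: affine_span_cst.
have mF u : F u -> measurable_fun setT (I u).
  rewrite /F /= in_itv/= => /past_in uT.
  rewrite (_ : I u = fun w => signal g Xr u w + A u w); last first.
    by apply/funext => w; rewrite /I rapE.
  apply: measurable_funD; last exact/mD/A_span.
  by apply: affine_span_measurable (signal_span g Xr u) => _ [i _ <-].
have mN V : N V -> measurable_fun setT V by move=> /N_D /mD.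
have cov_NA V W : N V -> SA W -> covariance P V W = 0%E.
  move=> [u + <-] [v + <-]; rewrite /= !in_itv/= => up /andP[sv vT].
  have L2 V' : affine_span (D @` [set` `[T 0%N, T n]]) V' -> V' \in Lfun P 2%:E.
    move=> DV; have [? [? []]] //:= shifted_gaussian_moments (mD _ DV)
      (gaussian_process_span gaussianD DV).
  have Au2 := L2 _ (A_span _ (past_in _ up)); have As2 := L2 _ (A_span _ sT').
  have Av2 : A v \in Lfun P 2%:E by apply/L2/A_span; rewrite (le_trans T0s sv).
  have sub12 (Z : Omega -> R) : Z \in Lfun P 2%:E -> Z \in Lfun P 1.
    by move=> Z2; apply: Lfun_subset12 => //; exact: fin_num_measure.
  have AA1 : A s * A v \in Lfun P 1 by exact: Lfun2_mul_Lfun1.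
  rewrite (_ : Q u = A u \- rho u \o* A s); last first.
    by apply/funext => w; rewrite /Q /= mulrC.
  rewrite covarianceBl// ?Lfun_scale ?ler1n//.
  rewrite (covarianceZl _ (sub12 _ As2) (sub12 _ Av2) AA1) cov_rho// subee//.
  by rewrite fin_numM// covariance_fin_num// sub12.
(* the residuals are uncorrelated with the noise from [s] on, hence independent
   of it, and all the noise is independent of [X] *)
have orthN V K : affine_span N V -> <<s C>> K ->
    \int[P]_(w in K) (cos (V w) - \int[P]_x cos (V x)) = 0.
  move=> NV CK; set c := \int[P]_x cos (V x).
  have DV := affine_span_subset N_D NV.
  have cV_i := integrable_cos P (mD _ DV).
  have h_i := integrable_subr_cst c cV_i.
  apply: (@cosine_test _ _ _ _ P (SX `|` SA) id) => // Y; rewrite image_id => SY.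
  apply: (Rintegral_cos_split mS h_i _ SY) => x a Xx Aa.
  have Da := affine_span_subset SA_D Aa.
  transitivity (\int[P]_w (cos (x w) * (cos (a w) * (cos (V w) - c)))).
    by apply: eq_Rintegral => w _; rewrite mulrA.
  have mXs := @sigma_of_measurable _ _ _ _ setT Xr (fun i _ => mX i).
  have mDs := @sigma_of_measurable _ _ _ _ [set` `[T 0%N, T n]] D processD.
  have Hk : sigma_measurable (sigma_of [set` `[T 0%N, T n]] D)
      (fun w => cos (a w) * (cos (V w) - c)).
    apply/sigma_measurableP; apply: measurable_funM.
      by apply/sigma_measurableP; exact: (sigma_measurable_cos (sigma_of_span Da)).
    apply: measurable_funB => //.
    by apply/sigma_measurableP; exact: (sigma_measurable_cos (sigma_of_span DV)).
  rewrite (independent_Rintegral (C := 1) (D := 1 * (1 + `|c|)) mXs mDs independentXD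
    (sigma_measurable_cos (sigma_of_span Xx)) Hk); last 2 first.
  - by move=> w; exact: cos_max.
  - move=> w; rewrite normrM ler_pM// ?cos_max//.
    by rewrite (le_trans (ler_normB _ _))// lerD2r cos_max.
  have ca_i := integrable_cos P (mD _ Da).
  have aV_i : P.-integrable setT (EFin \o (fun w => cos (a w) * cos (V w))).
    apply: (integrable_bounded_mul (C := 1) _ _ cV_i) => [|w]; last exact: cos_max.
    exact: measurable_cos_comp (mD _ Da).
  under [X in _ * X]eq_Rintegral do rewrite mulrBr.
  rewrite RintegralB//; last exact: (integrableZr _ c ca_i).
  rewrite RintegralZr// (uncorrelated_span_cos processD gaussianD SA_D N_D _ Aa NV).
    by rewrite subrr mulr0.
  by move=> V' W' SV' NW'; rewrite covarianceC; exact: cov_NA.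
have mH : sigma_of H I `<=` measurable by exact: subset_trans HC mC.
have [Y HY] := cond_prob_version_exists P mH (mC _ CE).
exists Y, Y; split => //; last exact: aeW.
exact: (cond_prob_version_enlarge mF mN mC HF HC CE FHN orthN HY).
Qed.
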